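(* Let $\Lambda$ be a G-semisimple algebra and $n\geq 1$. Then any indecomposable representation in $\mathcal{S}_n(\mathrm{Gprj}\text{-}\Lambda)$ is isomorphic to a representation of one of the following forms: either $$[i,j,G]:=(0\to\cdots\to 0\to \Omega_\Lambda(G)\xrightarrow{1}\Omega_\Lambda(G)\to\cdots\xrightarrow{1}\Omega_\Lambda(G)\xrightarrow{l}P\xrightarrow{1}\cdots\xrightarrow{1}P),$$ where $G$ is an indecomposable Gorenstein projective $\Lambda$-module, $1\leq i\leq j\leq n$, the first $\Omega_\Lambda(G)$ is placed at the $i$-th vertex and the last one at the $j$-th vertex, and the map $l$ attached to the arrow $v_j\to v_{j+1}$ is the inclusion $\Omega_\Lambda(G)\hookrightarrow P$; or $$[0,0,P]:=(P\xrightarrow{1}P\to\cdots\to P\xrightarrow{1}P),$$ where $P$ is an indecomposable projective $\Lambda$-module and all maps are the identity on $P$.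
   Context: Modules are finitely generated right modules. An object of an abelian category with enough projectives is Gorenstein projective if it is a syzygy of an acyclic complex $\mathbf{P}^\bullet$ of projective objects such that $\mathrm{Hom}(\mathbf{P}^\bullet,Q)$ is acyclic for every projective object $Q$. $\mathrm{Gprj}\text{-}\Lambda$ is the category of Gorenstein projective $\Lambda$-modules and $\underline{\mathrm{Gprj}}\text{-}\Lambda$ its stable category modulo projectives. $0\to\Omega_\Lambda(G)\to P\to G\to 0$ is the exact sequence with $P\to G$ a projective cover (so for $G$ projective, $\Omega_\Lambda(G)=0$ and $P=G$). If $j=n$ in $[i,j,G]$, no copy of $P$ occurs. For an additive category $\mathcal{X}$, $\mathrm{mod}\text{-}\mathcal{X}$ denotes the category of finitely presented contravariant additive functors from $\mathcal{X}$ to abelian groups. An Artin algebra $\Lambda$ (with $\mathrm{Gprj}\text{-}\Lambda$ contravariantly finite in $\mathrm{mod}\text{-}\Lambda$) is G-semisimple if $\mathrm{mod}\text{-}(\underline{\mathrm{Gprj}}\text{-}\Lambda)$ is a semisimple abelian category, i.e. all its objects are projective. $A_n=v_1\to\cdots\to v_n$ is the linear quiver with $n$ vertices, and $\mathcal{S}_n(\mathrm{Gprj}\text{-}\Lambda)=\mathrm{Gprj}(A_n,\Lambda)$ is the category of Gorenstein projective objects in the category $\mathrm{rep}(A_n,\Lambda)$ of representations $X_1\to\cdots\to X_n$ of $A_n$ by finitely generated $\Lambda$-modules. *)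

(* Defs.v *)
From HB Require Import structures.
From mathcomp Require Import all_boot all_order all_algebra.
From mathcomp Require Import boolp classical_sets prodnormedzmodule.

Set Implicit Arguments.
Unset Strict Implicit.
Unset Printing Implicit Defensive.

Import GRing.Theory.
Local Open Scope ring_scope.

Declare Scope category_scope.
Delimit Scope category_scope with cat.
Local Open Scope category_scope.

Record category := Category {
  obj :> Type;
  mor : obj -> obj -> Type;
  idm : forall x, mor x x;
  mcomp : forall x y z, mor y z -> mor x y -> mor x z;
  comp_idl : forall x y (f : mor x y), mcomp (idm y) f = f;
  comp_idr : forall x y (f : mor x y), mcomp f (idm x) = f;
  compA : forall x y z t (h : mor z t) (g : mor y z) (f : mor x y),
    mcomp h (mcomp g f) = mcomp (mcomp h g) f
}.

Arguments mor {c} x y.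
Arguments idm {c} x.
Arguments mcomp {c x y z} g f : rename.

Notation "g \oc f" := (mcomp g f)
  (at level 50, left associativity) : category_scope.

Section CategoryNotions.
Variable C : category.
Implicit Types x y z a b : C.

Definition monomorphism x y (f : mor x y) :=
  forall z (g h : mor z x), f \oc g = f \oc h -> g = h.

Definition epimorphism x y (f : mor x y) :=
  forall z (g h : mor y z), g \oc f = h \oc f -> g = h.

Definition isomorphic x y :=
  exists (f : mor x y) (g : mor y x), g \oc f = idm x /\ f \oc g = idm y.

Definition projective a :=
  forall x y (e : mor x y) (f : mor a y), epimorphism e ->
  exists g : mor a x, e \oc g = f.

Definition zero_object z :=
  (forall x, exists! f : mor z x, True) /\ (forall x, exists! f : mor x z, True).

Definition zero_mor x y (f : mor x y) :=
  exists z, zero_object z /\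
  exists (g : mor x z) (h : mor z y), f = h \oc g.

Definition is_kernel k x y (i : mor k x) (f : mor x y) :=
  zero_mor (f \oc i) /\
  forall t (u : mor t x), zero_mor (f \oc u) ->
  exists! v : mor t k, u = i \oc v.

Definition is_cokernel x y c (f : mor x y) (p : mor y c) :=
  zero_mor (p \oc f) /\
  forall t (u : mor y t), zero_mor (u \oc f) ->
  exists! v : mor c t, u = v \oc p.

Definition is_product a b x (p : mor x a) (q : mor x b) :=
  forall t (f : mor t a) (g : mor t b),
  exists! h : mor t x, f = p \oc h /\ g = q \oc h.

Definition is_coproduct a b x (i : mor a x) (j : mor b x) :=
  forall t (f : mor a t) (g : mor b t),
  exists! h : mor x t, f = h \oc i /\ g = h \oc j.

(* Being abelian is a property of the bare category: the additive structure   *)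
(* on the hom-sets is determined by these axioms.                             *)
Definition abelian_category :=
  (exists z, zero_object z) /\
  (forall a b, exists x (p : mor x a) (q : mor x b), is_product p q) /\
  (forall a b, exists x (i : mor a x) (j : mor b x), is_coproduct i j) /\
  (forall x y (f : mor x y), exists k (i : mor k x), is_kernel i f) /\
  (forall x y (f : mor x y), exists c (p : mor y c), is_cokernel f p) /\
  (forall x y (f : mor x y), monomorphism f ->
    exists z (g : mor y z), is_kernel f g) /\
  (forall x y (f : mor x y), epimorphism f ->
    exists z (g : mor z x), is_cokernel g f).

Definition semisimple_abelian_category :=
  abelian_category /\ forall x, projective x.

Definition indecomposable x :=
  ~ zero_object x /\
  forall a b (i : mor a x) (j : mor b x), is_coproduct i j ->
  zero_object a \/ zero_object b.

(* A projective object with an essential epimorphism; for modules, p is      *)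
(* essential exactly when its kernel is superfluous.                         *)
Definition projective_cover p x (e : mor p x) :=
  projective p /\ epimorphism e /\
  forall y (f : mor y p), epimorphism (e \oc f) -> epimorphism f.

(* Exactness at y in an abelian category: f is an epimorphism onto Ker g. *)
Definition exact_at x y z (f : mor x y) (g : mor y z) :=
  exists k (i : mor k y) (e : mor x k),
  is_kernel i g /\ epimorphism e /\ f = i \oc e.

Definition acyclic (P : int -> C) (d : forall i, mor (P i) (P (i + 1))) :=
  forall i, exact_at (d i) (d (i + 1)).

(* Exactness of Hom(P (i+2), q) -> Hom(P (i+1), q) -> Hom(P i, q) for all i,  *)
(* for a complex P.                                                           *)
Definition hom_acyclic (P : int -> C) (d : forall i, mor (P i) (P (i + 1))) q :=
  forall i (h : mor (P (i + 1)) q), zero_mor (h \oc d i) ->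
  exists h' : mor (P (i + 1 + 1)) q, h = h' \oc d (i + 1).

Definition gorenstein_projective a :=
  exists (P : int -> C) (d : forall i, mor (P i) (P (i + 1))),
  (forall i, projective (P i)) /\ acyclic d /\
  (forall q, projective q -> hom_acyclic d q) /\
  exists i (k : mor a (P i)), is_kernel k (d i).

Definition contravariantly_finite (S : C -> Prop) :=
  forall x, exists s (f : mor s x), S s /\
  forall t (g : mor t x), S t -> exists h : mor t s, g = f \oc h.

End CategoryNotions.

Definition full_subcategory (C : category) (S : C -> Prop) : category :=
  @Category {x : C | S x} (fun x y => mor (sval x) (sval y))
    (fun x => idm (sval x)) (fun x y z g f => g \oc f)
    (fun x y => @comp_idl C (sval x) (sval y))
    (fun x y => @comp_idr C (sval x) (sval y))
    (fun x y z t => @compA C (sval x) (sval y) (sval z) (sval t)).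

(* A separate record, because the universe of zmodType is too small for the   *)
(* morphisms between functors on a large category.                            *)
Record preadditive := Preadditive {
  pobj : Type;
  phom : pobj -> pobj -> zmodType;
  pid : forall x, phom x x;
  pcomp : forall x y z, phom y z -> phom x y -> phom x z;
  pcomp_idl : forall x y (f : phom x y), pcomp (pid y) f = f;
  pcomp_idr : forall x y (f : phom x y), pcomp f (pid x) = f;
  pcompA : forall x y z t (h : phom z t) (g : phom y z) (f : phom x y),
    pcomp h (pcomp g f) = pcomp (pcomp h g) f;
  pcompDl : forall x y z (g h : phom y z) (f : phom x y),
    pcomp (g + h) f = pcomp g f + pcomp h f;
  pcompDr : forall x y z (g : phom y z) (f h : phom x y),
    pcomp g (f + h) = pcomp g f + pcomp g h
}.

Arguments phom {p} x y.
Arguments pid {p} x.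
Arguments pcomp {p x y z} g f : rename.

Definition cat_of (A : preadditive) : category :=
  Category (@pcomp_idl A) (@pcomp_idr A) (@pcompA A).

Coercion cat_of : preadditive >-> category.

Definition pfull_subcategory (A : preadditive) (S : A -> Prop) : preadditive :=
  @Preadditive {x : A | S x} (fun x y => @phom A (sval x) (sval y))
    (fun x => @pid A (sval x))
    (fun x y z g f => @pcomp A (sval x) (sval y) (sval z) g f)
    (fun x y => @pcomp_idl A (sval x) (sval y))
    (fun x y => @pcomp_idr A (sval x) (sval y))
    (fun x y z t => @pcompA A (sval x) (sval y) (sval z) (sval t))
    (fun x y z => @pcompDl A (sval x) (sval y) (sval z))
    (fun x y z => @pcompDr A (sval x) (sval y) (sval z)).

Section PreadditiveTheory.
Variable A : preadditive.
Implicit Types x y z : pobj A.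

Lemma pcomp0r x y z (g : phom y z) : pcomp g 0 = 0 :> phom x z.
Proof. by apply: (addIr (pcomp g 0)); rewrite -pcompDr !add0r. Qed.

Lemma pcomp0l x y z (f : phom x y) : pcomp 0 f = 0 :> phom x z.
Proof. by apply: (addIr (pcomp 0 f)); rewrite -pcompDl !add0r. Qed.

Lemma pcompNr x y z (g : phom y z) (f : phom x y) :
  pcomp g (- f) = - pcomp g f.
Proof. by apply: (addIr (pcomp g f)); rewrite -pcompDr !addNr pcomp0r. Qed.

Lemma pcompNl x y z (g : phom y z) (f : phom x y) :
  pcomp (- g) f = - pcomp g f.
Proof. by apply: (addIr (pcomp g f)); rewrite -pcompDl !addNr pcomp0l. Qed.

Lemma pcompBr x y z (g : phom y z) (f h : phom x y) :
  pcomp g (f - h) = pcomp g f - pcomp g h.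
Proof. by rewrite pcompDr pcompNr. Qed.

Lemma pcompBl x y z (g h : phom y z) (f : phom x y) :
  pcomp (g - h) f = pcomp g f - pcomp h f.
Proof. by rewrite pcompDl pcompNl. Qed.

End PreadditiveTheory.

Record mor_ideal (A : preadditive) := MorIdeal {
  ideal_mem : forall x y : pobj A, zmodClosed (phom x y);
  ideal_compl : forall x y z (g : phom y z) (f : phom x y),
    f \in ideal_mem x y -> pcomp g f \in ideal_mem x z;
  ideal_compr : forall x y z (g : phom y z) (f : phom x y),
    g \in ideal_mem y z -> pcomp g f \in ideal_mem x z
}.

Section QuotientCategory.
Import Quotient.
Variables (A : preadditive) (I : mor_ideal A).
Local Open Scope quotient_scope.

Let Q (x y : pobj A) : zmodType := {quot ideal_mem I x y}.

Let cls x y (f : phom x y) : Q x y := \pi_({quot ideal_mem I x y}) f.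

Definition qcomp x y z (g : Q y z) (f : Q x y) : Q x z :=
  cls (pcomp (repr g) (repr f)).

Let clsP x y (f g : phom x y) :
  f - g \in ideal_mem I x y -> cls f = cls g.
Proof. by move=> fgI; apply/eqP; rewrite /cls -idealrBE. Qed.

Let reprP x y (f : phom x y) : repr (cls f) - f \in ideal_mem I x y.
Proof. by rewrite idealrBE reprK. Qed.

Lemma qcompE x y z (g : phom y z) (f : phom x y) :
  qcomp (cls g) (cls f) = cls (pcomp g f).
Proof.
apply: clsP; set g' := repr _; set f' := repr _.
rewrite -(subrKA (pcomp g' f)) -pcompBr -pcompBl.
by apply: rpredD; [apply: ideal_compl | apply: ideal_compr]; apply: reprP.
Qed.

Let clsK x y (f : Q x y) : cls (repr f) = f. Proof. exact: reprK. Qed.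

Let clsD x y (f g : phom x y) : cls (f + g) = cls f + cls g.
Proof. exact: raddfD. Qed.

Lemma qcomp_idl x y (f : Q x y) : qcomp (cls (pid y)) f = f.
Proof. by rewrite -[f]clsK qcompE pcomp_idl. Qed.

Lemma qcomp_idr x y (f : Q x y) : qcomp f (cls (pid x)) = f.
Proof. by rewrite -[f]clsK qcompE pcomp_idr. Qed.

Lemma qcompA x y z t (h : Q z t) (g : Q y z) (f : Q x y) :
  qcomp h (qcomp g f) = qcomp (qcomp h g) f.
Proof. by rewrite -[f]clsK -[g]clsK -[h]clsK !qcompE pcompA. Qed.

Lemma qcompDl x y z (g h : Q y z) (f : Q x y) :
  qcomp (g + h) f = qcomp g f + qcomp h f.
Proof.
by rewrite -[f]clsK -[g]clsK -[h]clsK -clsD !qcompE pcompDl clsD.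
Qed.

Lemma qcompDr x y z (g : Q y z) (f h : Q x y) :
  qcomp g (f + h) = qcomp g f + qcomp g h.
Proof.
by rewrite -[f]clsK -[g]clsK -[h]clsK -clsD !qcompE pcompDr clsD.
Qed.

Definition quotient_category : preadditive :=
  Preadditive qcomp_idl qcomp_idr qcompA qcompDl qcompDr.

End QuotientCategory.

Section Functors.
Variable A : preadditive.

Record ab_functor := AbFunctor {
  fobj :> pobj A -> zmodType;
  fmap : forall x y : pobj A, phom x y -> {additive fobj y -> fobj x};
  fmap_id : forall x (a : fobj x), fmap (pid x) a = a;
  fmap_comp : forall x y z (g : phom y z) (f : phom x y) (a : fobj z),
    fmap (pcomp g f) a = fmap f (fmap g a);
  fmapD : forall x y (f g : phom x y) (a : fobj y),
    fmap (f + g) a = fmap f a + fmap g a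
}.

Record nat_trans (F G : ab_functor) := NatTrans {
  ntrans :> forall x, {additive F x -> G x};
  ntransP : forall x y (f : phom x y) (a : F y),
    ntrans x (fmap F f a) = fmap G f (ntrans y a)
}.

Lemma additive_eq (U V : zmodType) (f g : {additive U -> V}) :
  f =1 g -> f = g.
Proof.
case: f g => [f [[fD]]] [g [[gD]]] /= /funext fg.
by case: _ / fg in gD *; rewrite (Prop_irrelevance fD gD).
Qed.

Lemma nat_trans_eq F G (u v : nat_trans F G) :
  (forall x, u x =1 v x) -> u = v.
Proof.
case: u v => [u uP] [v vP] /= uv.
have {}uv : u = v.
  by apply: functional_extensionality_dep => x; apply: additive_eq (uv x).
by case: _ / uv in vP *; rewrite (Prop_irrelevance uP vP).
Qed.

Definition nt_id F : nat_trans F F :=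
  @NatTrans F F (fun x => idfun) (fun x y f a => erefl).

Lemma nt_compP F G H (v : nat_trans G H) (u : nat_trans F G) x y
    (f : phom x y) (a : F y) :
  (v x \o u x) (fmap F f a) = fmap H f ((v y \o u y) a).
Proof. by rewrite /= !ntransP. Qed.

Definition nt_comp F G H (v : nat_trans G H) (u : nat_trans F G) :
    nat_trans F H :=
  @NatTrans F H (fun x => v x \o u x) (nt_compP v u).

Definition functor_category : category.
Proof.
by apply: (@Category ab_functor nat_trans nt_id nt_comp) => *;
  apply: nat_trans_eq.
Defined.

Section Representable.
Variable c : pobj A.

Definition precomp x y (f : phom x y) (g : phom y c) : phom x c := pcomp g f.

Lemma precompB x y (f : phom x y) : zmod_morphism (precomp f).
Proof. by move=> g h; rewrite /precomp pcompBl. Qed.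

HB.instance Definition _ x y (f : phom x y) :=
  GRing.isZmodMorphism.Build (phom y c) (phom x c) (precomp f) (precompB f).

Definition representable : ab_functor :=
  @AbFunctor (fun x => phom x c) (fun x y f => precomp f)
    (fun x g => pcomp_idr g)
    (fun x y z g f h => pcompA h g f)
    (fun x y f g h => pcompDr h f g).

End Representable.

Definition finitely_presented (F : ab_functor) :=
  exists x y (u : nat_trans (representable x) (representable y))
             (v : nat_trans (representable y) F),
  (forall z (a : F z), exists b, a = v z b) /\
  (forall z (b : representable y z), v z b = 0 <-> exists c, b = u z c).

Definition mod_category : category :=
  full_subcategory (C := functor_category) finitely_presented.

End Functors.

Definition fin_gen (R : pzRingType) (M : lmodType R) :=
  exists m (s : 'I_m -> M), forall x, exists c : 'I_m -> R,
  x = \sum_(i < m) c i *: s i.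

Section LinearMaps.
Variables (R : pzRingType) (M N : lmodType R).

Lemma linear_eq (f g : {linear M -> N}) : f =1 g -> f = g.
Proof.
case: f g => [f [[fD] [fZ]]] [g [[gD] [gZ]]] /= /funext fg.
case: _ / fg in gD gZ *.
by rewrite (Prop_irrelevance fD gD) (Prop_irrelevance fZ gZ).
Qed.

Definition lin_zero : {linear M -> N} := \0.
Definition lin_opp (f : {linear M -> N}) : {linear M -> N} := \- f.
Definition lin_add (f g : {linear M -> N}) : {linear M -> N} := f \+ g.

Lemma lin_addA : associative lin_add.
Proof. by move=> f g h; apply: linear_eq => x /=; rewrite addrA. Qed.
Lemma lin_addC : commutative lin_add.
Proof. by move=> f g; apply: linear_eq => x /=; rewrite addrC. Qed.
Lemma lin_add0 : left_id lin_zero lin_add.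
Proof. by move=> f; apply: linear_eq => x /=; rewrite add0r. Qed.
Lemma lin_addN : left_inverse lin_zero lin_opp lin_add.
Proof. by move=> f; apply: linear_eq => x /=; rewrite addNr. Qed.

HB.instance Definition _ := GRing.isZmodule.Build {linear M -> N}
  lin_addA lin_addC lin_add0 lin_addN.

End LinearMaps.

Definition lmod_category (R : pzRingType) : preadditive.
Proof.
apply: (@Preadditive (lmodType R) (fun M N => {linear M -> N})
  (fun M => idfun) (fun M N K g f => g \o f)).
- by move=> *; apply: linear_eq.
- by move=> *; apply: linear_eq.
- by move=> *; apply: linear_eq.
- by move=> *; apply: linear_eq.
- by move=> M N K g f h; apply: linear_eq => x; exact: (raddfD g).
Defined.

(* lmodType has left modules only: finitely generated right L-modules are     *)
(* the objects of fgmod L^c, where L^c is the opposite ring.                  *)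
Definition fgmod (R : pzRingType) : preadditive :=
  pfull_subcategory (A := lmod_category R) (@fin_gen R).

Lemma fin_gen0 (R : pzRingType) : fin_gen 'rV[R]_0.
Proof.
exists 0, (fun=> 0) => x; exists (fun=> 0).
by rewrite big_ord0; exact: thinmx0.
Qed.

Definition fgmod0 (R : pzRingType) : fgmod R :=
  exist (@fin_gen R) 'rV[R]_0 (fin_gen0 R).

Section StableCategory.
Variable R : pzRingType.

Lemma fin_gen_pair (M N : lmodType R) :
  fin_gen M -> fin_gen N -> fin_gen (M * N)%type.
Proof.
move=> [m [s sP]] [n [t tP]].
exists (m + n)%N, (fun i => match split i with
  | inl j => (s j, 0) | inr j => (0, t j) end) => -[x y].
have [[c ->] [d ->]] := (sP x, tP y).
exists (fun i => match split i with inl j => c j | inr j => d j end).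
have spl (i : 'I_m) : split (lshift n i) = inl i := unsplitK (inl i).
have spr (i : 'I_n) : split (rshift m i) = inr i := unsplitK (inr i).
rewrite big_split_ord /=.
transitivity (\sum_(i < m) c i *: (s i, 0 : N) +
              \sum_(i < n) d i *: (0 : M, t i)).
  apply/eqP; rewrite xpair_eqE /=; apply/andP; split; apply/eqP.
    rewrite !(raddf_sum fst) /= [X in _ = _ + X]big1 ?addr0 // => i _.
    exact: scaler0.
  rewrite !(raddf_sum snd) /= [X in _ = X + _]big1 ?add0r // => i _.
  exact: scaler0.
by congr (_ + _); apply: eq_bigr => i _; rewrite ?spl ?spr.
Qed.

Definition fg_pair (M N : fgmod R) : fgmod R :=
  exist (@fin_gen R) (sval M * sval N)%type
    (fin_gen_pair (proj2_sig M) (proj2_sig N)).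

Section Pairing.
Variables M N : fgmod R.

Definition pair_inl (x : sval M) : sval M * sval N := (x, 0).
Definition pair_inr (y : sval N) : sval M * sval N := (0, y).

Lemma pair_inl_linear : linear pair_inl.
Proof. by move=> a x y; congr pair; rewrite /= ?scaler0 ?addr0. Qed.
Lemma pair_inr_linear : linear pair_inr.
Proof. by move=> a x y; congr pair; rewrite /= ?scaler0 ?addr0. Qed.

HB.instance Definition _ :=
  GRing.isLinear.Build R (sval M) (sval M * sval N)%type *:%R
    pair_inl pair_inl_linear.
HB.instance Definition _ :=
  GRing.isLinear.Build R (sval N) (sval M * sval N)%type *:%R
    pair_inr pair_inr_linear.

Definition fg_inl : phom M (fg_pair M N) := (pair_inl : {linear _ -> _}).
Definition fg_inr : phom N (fg_pair M N) := (pair_inr : {linear _ -> _}).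
Definition fg_fst : phom (fg_pair M N) M := (fst : {linear _ -> _}).
Definition fg_snd : phom (fg_pair M N) N := (snd : {linear _ -> _}).

Lemma fg_pair_id :
  pcomp fg_inl fg_fst + pcomp fg_inr fg_snd = pid (fg_pair M N).
Proof.
apply: linear_eq => -[x y]; congr pair; [exact: addr0 | exact: add0r].
Qed.

Lemma fg_fst_inl : pcomp fg_fst fg_inl = pid M.
Proof. exact: linear_eq. Qed.
Lemma fg_snd_inr : pcomp fg_snd fg_inr = pid N.
Proof. exact: linear_eq. Qed.
Lemma fg_fst_inr : pcomp fg_fst fg_inr = 0.
Proof. exact: linear_eq. Qed.
Lemma fg_snd_inl : pcomp fg_snd fg_inl = 0.
Proof. exact: linear_eq. Qed.

Lemma projective_pair :
  projective M -> projective N -> projective (fg_pair M N).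
Proof.
move=> prM prN x y e f epi_e.
have [g gE] := prM _ _ e (pcomp f fg_inl : mor M y) epi_e.
have [h hE] := prN _ _ e (pcomp f fg_inr : mor N y) epi_e.
change (pcomp (p := fgmod R) e g = pcomp f fg_inl) in gE.
change (pcomp (p := fgmod R) e h = pcomp f fg_inr) in hE.
exists (pcomp (p := fgmod R) g fg_fst + pcomp (p := fgmod R) h fg_snd).
change (pcomp (p := fgmod R) e
  (pcomp (p := fgmod R) g fg_fst + pcomp (p := fgmod R) h fg_snd) = f).
rewrite pcompDr !pcompA gE hE -!pcompA -pcompDr fg_pair_id.
exact: pcomp_idr.
Qed.

End Pairing.

Lemma projective_fgmod0 : projective (fgmod0 R).
Proof.
move=> x y e f _; exists (0 : phom (fgmod0 R) x).
by apply: linear_eq => v; rewrite (thinmx0 v) !raddf0.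
Qed.

Definition factors_through_projective (M N : fgmod R) (f : phom M N) :=
  exists P : fgmod R, projective P /\
  exists (g : phom M P) (h : phom P N), f = pcomp h g.

Definition projective_maps (M N : fgmod R) : {pred phom M N} :=
  [pred f | `[< factors_through_projective f >]].

Lemma projective_mapsP (M N : fgmod R) (f : phom M N) :
  reflect (factors_through_projective f) (f \in @projective_maps M N).
Proof. exact: asboolP. Qed.

Lemma projective_maps_zmod (M N : fgmod R) :
  zmod_closed (@projective_maps M N).
Proof.
split=> [|f f'].
  apply/projective_mapsP; exists (fgmod0 R).
  split; [exact: projective_fgmod0 | exists 0, 0].
  exact: esym (@pcomp0l (fgmod R) _ _ _ _).
move=> /projective_mapsP[P [prP [u [v ->]]]].
move=> /projective_mapsP[P' [prP' [u' [v' ->]]]].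
apply/projective_mapsP; exists (fg_pair P P').
split; first exact: projective_pair.
exists (pcomp (fg_inl P P') u - pcomp (fg_inr P P') u').
exists (pcomp v (fg_fst P P') + pcomp v' (fg_snd P P')).
by apply: linear_eq => x /=; rewrite subr0 sub0r raddfN.
Qed.

HB.instance Definition _ (M N : fgmod R) :=
  GRing.isZmodClosed.Build (phom M N) (@projective_maps M N)
    (projective_maps_zmod M N).

Lemma projective_maps_compl (M N K : fgmod R) (g : phom N K) (f : phom M N) :
  f \in @projective_maps M N -> pcomp g f \in @projective_maps M K.
Proof.
move=> /projective_mapsP[P [prP [u [v ->]]]]; apply/projective_mapsP.
by exists P; split=> //; exists u, (pcomp g v); rewrite pcompA.
Qed.

Lemma projective_maps_compr (M N K : fgmod R) (g : phom N K) (f : phom M N) :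
  g \in @projective_maps N K -> pcomp g f \in @projective_maps M K.
Proof.
move=> /projective_mapsP[P [prP [u [v ->]]]]; apply/projective_mapsP.
by exists P; split=> //; exists (pcomp u f), v; rewrite pcompA.
Qed.

Definition projective_ideal : mor_ideal (fgmod R) :=
  @MorIdeal (fgmod R) (fun M N => @projective_maps M N)
    projective_maps_compl projective_maps_compr.

Definition stable_fgmod : preadditive := quotient_category projective_ideal.

(* The objects are Gorenstein projective in fgmod R, not in stable_fgmod. *)
Definition stable_gprj : preadditive :=
  pfull_subcategory (A := stable_fgmod)
    (fun M => gorenstein_projective (M : fgmod R)).

End StableCategory.

Record quiver := Quiver { vertex :> Type; arrow : vertex -> vertex -> Type }.

(* 'I_n is zero-based: v_1, .., v_n are the ordinals 0, .., n - 1. *)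
Definition linear_quiver (n : nat) : quiver :=
  @Quiver 'I_n (fun i j => i.+1 = j :> nat).

Section Representations.
Variables (Q : quiver) (C : category).

Record quiver_rep := QuiverRep {
  rep_obj :> Q -> C;
  rep_map : forall i j : Q, arrow i j -> mor (rep_obj i) (rep_obj j)
}.

Record rep_hom (X Y : quiver_rep) := RepHom {
  rep_fun :> forall i : Q, mor (X i) (Y i);
  rep_homP : forall (i j : Q) (a : arrow i j),
    rep_fun j \oc rep_map X a = rep_map Y a \oc rep_fun i
}.

Lemma rep_hom_eq X Y (f g : rep_hom X Y) : (forall i, f i = g i) -> f = g.
Proof.
case: f g => [f fP] [g gP] /= fg.
have {}fg : f = g by apply: functional_extensionality_dep.
by case: _ / fg in gP *; rewrite (Prop_irrelevance fP gP).
Qed.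

Lemma rep_idP (X : quiver_rep) (i j : Q) (a : arrow i j) :
  idm (X j) \oc rep_map X a = rep_map X a \oc idm (X i).
Proof. by rewrite comp_idl comp_idr. Qed.

Lemma rep_compP X Y Z (g : rep_hom Y Z) (f : rep_hom X Y)
    (i j : Q) (a : arrow i j) :
  (g j \oc f j) \oc rep_map X a = rep_map Z a \oc (g i \oc f i).
Proof. by rewrite -compA rep_homP compA rep_homP compA. Qed.

Definition rep_category : category.
Proof.
apply: (@Category quiver_rep rep_hom
  (fun X => RepHom (@rep_idP X))
  (fun X Y Z g f => RepHom (rep_compP g f))).
- by move=> X Y f; apply: rep_hom_eq => i; exact: comp_idl.
- by move=> X Y f; apply: rep_hom_eq => i; exact: comp_idr.
- by move=> X Y Z T h g f; apply: rep_hom_eq => i; exact: compA.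
Defined.

Definition constant_rep (x : C) : rep_category :=
  @QuiverRep (fun=> x) (fun i j _ => idm x).

End Representations.

Arguments constant_rep {Q C} x.

(* The representation 0 -> .. -> 0 -> k = .. = k -> p = .. = p of A_n, where  *)
(* the vertices with k are v_i, .., v_j (1 <= i <= j <= n), all arrows within *)
(* a block are identities and the arrow v_j -> v_(j+1), if any, is l.         *)
Section Bracket.
Variables (A : preadditive) (z k p : A) (l : phom k p).

Inductive bracket_block := BlockZ | BlockK | BlockP.

Definition block_obj (b : bracket_block) : pobj A :=
  match b with BlockZ => z | BlockK => k | BlockP => p end.

(* Only the cases b <= c occur along the arrows of A_n. *)
Definition block_map (b c : bracket_block) : phom (block_obj b) (block_obj c) :=
  match b, c with
  | BlockK, BlockK => pid k
  | BlockK, BlockP => l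
  | BlockP, BlockP => pid p
  | _, _ => 0
  end.

Definition block_of (i j v : nat) : bracket_block :=
  if (v < i)%N then BlockZ else if (v <= j)%N then BlockK else BlockP.

Definition bracket_rep (n i j : nat) : rep_category (linear_quiver n) A :=
  @QuiverRep (linear_quiver n) A
    (fun v => block_obj (block_of i j v.+1))
    (fun v w _ => block_map (block_of i j v.+1) (block_of i j w.+1)).

End Bracket.

Definition is_ideal (k : comPzRingType) (I : set k) :=
  I 0 /\ (forall x y, I x -> I y -> I (x + y)) /\
  (forall a x, I x -> I (a * x)).

Definition artinian (k : comPzRingType) :=
  forall I : nat -> set k, (forall m, is_ideal (I m)) ->
  (forall m, (I m.+1 `<=` I m)%classic) ->
  exists m0, forall m, (m0 <= m)%N -> I m = I m0.

Definition artin_algebra (k : comPzRingType) (L : algType k) :=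
  artinian k /\ fin_gen (L : lmodType k).

Definition G_semisimple (k : comPzRingType) (L : algType k) :=
  artin_algebra L /\
  contravariantly_finite (@gorenstein_projective (fgmod L^c)) /\
  semisimple_abelian_category (mod_category (stable_gprj L^c)).

(* Main.v *)
From HB Require Import structures.
From mathcomp Require Import all_boot all_order all_algebra.
From mathcomp Require Import zify.
From mathcomp Require Import boolp.
Require Import Defs.

(** The category of representations is studied through evaluation at the
    vertices.  Evaluation at [v] has a left adjoint [ind v] and a right adjoint
    [coind v], so it preserves kernels, epimorphisms and projectives.  Moreover
    [coind v q] is the cokernel of [ind (v + 1) q -> constant_rep q], a map between
    projectives when [q] is projective.  Hence a Gorenstein projective
    representation [X] has Gorenstein projective values
    ([gorenstein_projective_at]), and every map from [X v] to a projective extends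
    along the maps of [X] ([gorenstein_projective_path_extension]).

    Semisimplicity of the functor category makes the stable category von Neumann
    regular ([stable_regular]): every [f] between Gorenstein projectives equals
    [f g f] for some [g], up to maps through projectives.  Over an Artin algebra
    endomorphisms have Fitting decompositions and chains of direct summands
    stabilize ([fitting_fgmod], [idempotent_dcc_fgmod]), so if [f] does not factor
    through a projective, then an indecomposable nonprojective module [M] is a
    direct summand of the source of [f] that [f] embeds as a direct summand of
    its target ([stable_splitting]).

    Now let [X] be indecomposable and [i] the first vertex with [X i] nonzero.  If
    [X i] is projective, its identity extends to the last vertex, so the
    representation equal to [X i] from [i] on is a direct summand of [X], hence all
    of [X]; for [i] the first vertex this is the constant form, and otherwise the
    bracket form with [G = P = X i] and zero syzygy.

    If [X i] is not projective, let [j] be the last vertex for which [X i -> X j]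
    does not factor through a projective, and take [M] as above for this map.  A
    left minimal embedding [l] of [M] into a direct summand [P] of a term of a
    totally acyclic complex with kernel [X i] yields the bracket representation
    with value [M] from [i] to [j] and value [P] afterwards.  The map from [M] to
    [X (j + 1)] factors through a projective and thus extends to [P]; the map
    from [X j] to [M], followed by [l], extends to the last vertex.  By left
    minimality these maps make the bracket a direct summand of [X]
    ([bracket_maps], [isomorphic_bracket]), hence all of [X].

    It remains to see that [l] is the kernel of the projective cover of an
    indecomposable Gorenstein projective module [G].  The isomorphism identifies [M]
    with [X i], so [M] is a kernel in the totally acyclic complex; removing the
    complement of [P], which is a contractible summand, exhibits [G = P / M] as a
    kernel in the remaining complex ([kernel_cosyzygy]).  As [M] is indecomposable
    and not projective, [P -> G] is a projective cover ([kernel_projective_cover])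
    and [G] is indecomposable ([kernel_indecomposable]). *)

Set Implicit Arguments.
Unset Strict Implicit.
Unset Printing Implicit Defensive.

Import GRing.Theory.
Local Open Scope ring_scope.
Local Open Scope category_scope.

Notation "g \pc f" := (pcomp g f) (at level 40, left associativity) : ring_scope.

(** * Preadditive categories *)

Section Preadditive.
Variable A : preadditive.
Implicit Types x y z : pobj A.

(** For rewriting inside a composite that is associated to the right. *)
Lemma pcomp_reassoc x y z (g : phom y z) (f : phom x y) (h : phom x z) :
  g \pc f = h -> forall t (k : phom t x), g \pc (f \pc k) = h \pc k.
Proof. by move=> <- t k; rewrite pcompA. Qed.

Lemma zero_objectP x : zero_object (x : A) <-> pid x = 0.
Proof.
split=> [[_ /(_ x)[f [_ fP]]]|x0]; first by rewrite -(fP (pid x) I) -(fP 0 I).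
split=> y; exists 0; split=> // f _.
  by rewrite -[f](@pcomp_idr A) x0 pcomp0r.
by rewrite -[f](@pcomp_idl A) x0 pcomp0l.
Qed.

Lemma zero_object_hom0 x y (f : phom x y) : pid x = 0 -> f = 0.
Proof. by move=> x0; rewrite -[f]pcomp_idr x0 pcomp0r. Qed.

Lemma hom0_zero_object x y (f : phom x y) : pid y = 0 -> f = 0.
Proof. by move=> y0; rewrite -[f]pcomp_idl y0 pcomp0l. Qed.

Lemma epiP x y (e : phom x y) :
  epimorphism (e : mor (x : A) y) <->
  forall z (g : phom y z), g \pc e = 0 -> g = 0.
Proof.
split=> [eE z g ge0|eE z g h ghE].
  by apply: eE; rewrite [LHS]ge0 [RHS]pcomp0l.
by apply/eqP; rewrite -subr_eq0; apply/eqP/eE; rewrite pcompBl [g \pc e]ghE subrr.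
Qed.

Section WithZero.
Variables (o : pobj A) (o0 : zero_object (o : A)).

Lemma zero_morP x y (f : phom x y) : zero_mor (f : mor (x : A) y) <-> f = 0.
Proof.
split=> [[z [/zero_objectP z0 [g [h ->]]]]|->].
  by rewrite (zero_object_hom0 h z0) [LHS]pcomp0l.
by exists o; split=> //; exists (0 : phom x o), (0 : phom o y); rewrite [RHS]pcomp0l.
Qed.

Lemma kernelP a x y (i : phom a x) (f : phom x y) :
  is_kernel (i : mor (a : A) x) f <->
  [/\ f \pc i = 0,
      (forall t (u : phom t x), f \pc u = 0 -> exists v, u = i \pc v) &
      (forall t (v : phom t a), i \pc v = 0 -> v = 0)].
Proof.
split=> [[/zero_morP fi0 iP]|[fi0 iP i_inj]].
  split=> // [t u /zero_morP/iP[v [-> _]]|t v iv0]; first by exists v.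
  have /iP[w [_ wU]] : zero_mor (f \pc (i \pc v) : mor (t : A) y).
    by apply/zero_morP; rewrite iv0 pcomp0r.
  by rewrite -(wU v erefl); apply: wU; rewrite iv0 [RHS]pcomp0r.
split=> [|t u /zero_morP/iP[v ->]]; first exact/zero_morP.
exists v; split=> // w vw; apply/eqP; rewrite -subr_eq0; apply/eqP/i_inj.
by rewrite pcompBr [X in X - _]vw subrr.
Qed.

End WithZero.

Lemma projective_retract x y (r : phom x y) (s : phom y x) :
  r \pc s = pid y -> projective (x : A) -> projective (y : A).
Proof.
move=> rs prx a b e f epi_e.
have [g gE] := prx a b e (f \pc r) epi_e; exists (g \pc s).
by rewrite [LHS]pcompA [e \pc g]gE -pcompA rs pcomp_idr.
Qed.

Definition endo x : Type := phom x x.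

HB.instance Definition _ x := GRing.Zmodule.on (endo x).
HB.instance Definition _ x := GRing.Zmodule_isPzRing.Build (endo x)
  (fun h g f => @pcompA A x x x x h g f) (@pcomp_idl A x x) (@pcomp_idr A x x)
  (fun g h f => @pcompDl A x x x g h f) (fun g f h => @pcompDr A x x x g f h).

Lemma endoM x (f g : endo x) : f * g = f \pc g. Proof. by []. Qed.
Lemma endo1 x : (1 : endo x) = pid x. Proof. by []. Qed.

Lemma idem_compl x (e : endo x) : e * e = e -> (1 - e) * (1 - e) = 1 - e.
Proof. by move=> ee; rewrite mulrBl mul1r mulrBr mulr1 ee subrr subr0. Qed.

Definition split_idempotents := forall x (e : endo x), e * e = e ->
  exists y (r : phom x y) (s : phom y x), r \pc s = pid y /\ s \pc r = e.

Lemma split_complement x y y' (e : endo x) (r : phom x y) (s : phom y x)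
    (r' : phom x y') (s' : phom y' x) :
  r \pc s = pid y -> s \pc r = e -> r' \pc s' = pid y' -> s' \pc r' = 1 - e ->
  [/\ r \pc s' = 0, r' \pc s = 0 & s \pc r + s' \pc r' = pid x].
Proof.
move=> rs srE rs' srE'.
have ee : e * e = e by rewrite -srE endoM -!pcompA [r \pc (s \pc r)]pcompA rs pcomp_idl.
split; last by rewrite srE srE' addrC subrK.
  rewrite -[r]pcomp_idl -rs -[s']pcomp_idr -rs' -!pcompA [s \pc (r \pc _)]pcompA.
  rewrite srE [s' \pc (r' \pc _)]pcompA srE' [e \pc _]pcompA -!endoM.
  by rewrite mulrBr mulr1 ee subrr pcomp0l pcomp0r.
rewrite -[r']pcomp_idl -rs' -[s]pcomp_idr -rs -!pcompA [s' \pc (r' \pc _)]pcompA.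
rewrite srE' [s \pc (r \pc _)]pcompA srE [_ \pc (e \pc s)]pcompA -!endoM.
by rewrite mulrBl mul1r ee subrr pcomp0l pcomp0r.
Qed.

Section Indecomposable.
Hypothesis splitA : split_idempotents.

(** Splitting [e] and [1 - e] writes [x] as the coproduct of their images. *)
Lemma indecomposable_idem x (e : endo x) :
  indecomposable (x : A) -> e * e = e -> e = 0 \/ e = 1.
Proof.
move=> [_ xI] ee.
have [y [r [s [rs srE]]]] := splitA ee.
have [y' [r' [s' [rs' srE']]]] := splitA (idem_compl ee).
have [rs0 rs0' sum1] := split_complement rs srE rs' srE'.
have coprod : is_coproduct (s : mor (y : A) x) (s' : mor (y' : A) x).
  move=> t f g; exists (f \pc r + g \pc r'); split.
    rewrite [X in f = X]pcompDl -!pcompA rs rs0' pcomp_idr pcomp0r addr0.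
    by rewrite [X in g = X]pcompDl -!pcompA rs0 rs' pcomp_idr pcomp0r add0r.
  move=> h [-> ->]; rewrite -[RHS]pcomp_idr -sum1 pcompDr.
  by congr (_ + _); rewrite [RHS]pcompA.
have [/zero_objectP y0|/zero_objectP y0] := xI _ _ _ _ coprod.
  by left; rewrite -srE (zero_object_hom0 s y0) pcomp0l.
right; apply/eqP; rewrite eq_sym -subr_eq0; apply/eqP.
by rewrite -srE' (zero_object_hom0 s' y0) pcomp0l.
Qed.

End Indecomposable.

Lemma idem_indecomposable x : pid x <> 0 ->
  (forall e : endo x, e * e = e -> e = 0 \/ e = 1) -> indecomposable (x : A).
Proof.
move=> x0 eP; split=> [/zero_objectP//|a b i j ijP].
have [p [[pi pj] _]] := ijP a (pid a) 0.
change (pid a = (p : phom x a) \pc i) in pi.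
change (0 = (p : phom x a) \pc j) in pj.
have ipI : ((i : phom a x) \pc p : endo x) * (i \pc p) = i \pc p.
  by rewrite endoM -pcompA [p \pc (_ \pc _)]pcompA -pi pcomp_idl.
have [ip|ip] := eP _ ipI; [left|right]; apply/zero_objectP.
  by rewrite pi -[p]pcomp_idl {1}pi -[_ \pc p]pcompA ip pcomp0r pcomp0l.
have j0 : j = 0 :> phom b x.
  by rewrite -[j](@pcomp_idl A) -endo1 -ip -pcompA -pj pcomp0r.
have [q [[_ qj] _]] := ijP b 0 (pid b).
by change (pid b = (q : phom x b) \pc j) in qj; rewrite qj j0 pcomp0r.
Qed.

End Preadditive.

(** * Endomorphism rings with a Fitting decomposition *)

(** Put [alpha = a ^+ N.+1].  The hypotheses give [alpha = u alpha^2] and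
    [alpha = alpha^2 v], and then [u alpha = alpha v] is an idempotent that acts
    on [alpha] as the identity and in whose corner [alpha] is invertible. *)
Lemma strongly_pi_regular (E : pzRingType) (a b c : E) N :
  a ^+ N = b * a ^+ N.+1 -> a ^+ N = a ^+ N.+1 * c ->
  exists n (e d : E), [/\ (0 < n)%N, e * e = e, a ^+ n * e = a ^+ n,
                          d * a ^+ n = e & a ^+ n * d = e].
Proof.
move=> abE acE.
have bE j : a ^+ N.+1 = b ^+ j * a ^+ (N.+1 + j).
  elim: j => [|j IHj]; first by rewrite expr0 mul1r addn0.
  by rewrite {1}IHj {1}addSnnS exprD abE -[b * _ * _]mulrA -exprD mulrA -exprSr.
have cE j : a ^+ N.+1 = a ^+ (j + N.+1) * c ^+ j.
  elim: j => [|j IHj]; first by rewrite expr0 mulr1 add0n.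
  rewrite {1}IHj {1}addnS -addSn exprD acE [a ^+ j.+1 * _]mulrA -exprD.
  by rewrite -mulrA -exprS.
move: (bE N.+1) (cE N.+1); rewrite !exprD.
set al := a ^+ N.+1; set u := b ^+ _; set v := c ^+ _ => uE vE.
have uvE : u * al = al * v by rewrite {1}vE !mulrA -[u * al * al]mulrA -uE.
have alE : al * (al * v) = al by rewrite mulrA -vE.
exists N.+1, (al * v), (u * al * v); split=> //.
- by rewrite -{1}uvE -mulrA alE.
- by rewrite -[u * al * v]mulrA -uvE -!mulrA -uE.
- by rewrite uvE mulrA alE.
Qed.

Section Fitting.
Variable A : preadditive.
Implicit Types x y : pobj A.

(** The image and the kernel of a high power of [f] are complementary summands
    of [x], namely those of [e] and of [1 - e]. *)
Definition fitting_object x := forall f : endo x,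
  exists n (e d : endo x), [/\ (0 < n)%N, e * e = e, f ^+ n * e = f ^+ n,
                               d * f ^+ n = e & f ^+ n * d = e].

(** The images of the [E t] form a descending chain of direct summands of [x]. *)
Definition idempotent_dcc x := forall E : nat -> endo x,
  (forall t, [/\ E t * E t = E t, E t * E t.+1 = E t.+1 &
                 E t.+1 * E t = E t.+1]) ->
  exists t, E t.+1 = E t.

Lemma minimal_idempotent x (S : endo x -> Prop) e0 :
  idempotent_dcc x -> e0 * e0 = e0 -> S e0 ->
  exists e, [/\ e * e = e, S e & forall e', e' * e' = e' -> S e' ->
    e * e' = e' -> e' * e = e' -> e' = e].
Proof.
move=> dcc e0I Se0; apply: contrapT => noMin.
pose T := {e : endo x | e * e = e /\ S e}.
have next (e : T) : {e' : T | [/\ sval e * sval e' = sval e',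
     sval e' * sval e = sval e' & sval e' <> sval e]}.
  apply: cid; apply: contrapT => noNext; apply: noMin; exists (sval e).
  case: e noNext => e [eI Se] /= noNext; split=> // e' eI' Se' ee' e'e.
  apply: contrapT => neq; apply: noNext.
  by exists (exist _ e' (conj eI' Se')).
pose E t := iter t (fun e => sval (next e)) (exist _ e0 (conj e0I Se0) : T).
have EP t := svalP (next (E t)).
have [t|t Et] := dcc (fun t => sval (E t)); first split.
- by case: (svalP (E t)).
- by case: (EP t).
- by case: (EP t).
- by have [_ _ /(_ Et)] := EP t.
Qed.

Definition invertible x (f : endo x) := exists g : endo x, f * g = 1 /\ g * f = 1.

Lemma expr_invertible x (f : endo x) n :
  (0 < n)%N -> invertible (f ^+ n) -> invertible f.
Proof.
case: n => // n _ [g [fg gf]].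
have fgK : f * (f ^+ n * g) = 1 by rewrite mulrA -exprS.
have gfK : (g * f ^+ n) * f = 1 by rewrite -mulrA -exprSr.
have fgE : f ^+ n * g = g * f ^+ n.
  by rewrite -[LHS]mul1r -gfK -mulrA fgK mulr1.
by exists (f ^+ n * g); rewrite fgK fgE gfK.
Qed.

(** Fitting's lemma: an object without nontrivial idempotents has a local
    endomorphism ring. *)
Lemma fitting_local x (f : endo x) : fitting_object x ->
  (forall e : endo x, e * e = e -> e = 0 \/ e = 1) ->
  invertible f \/ exists n, f ^+ n = 0.
Proof.
move=> /(_ f)[n [e [d [n0 eI fe df fd]]]] eP.
have [e0|e1] := eP e eI; [right|left].
  by exists n; rewrite -fe e0 mulr0.
by apply: (expr_invertible n0); exists d; rewrite fd df e1.
Qed.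

Lemma nilpotent_invertible x (f : endo x) n : f ^+ n = 0 -> invertible (1 - f).
Proof.
move=> fn0; pose S := \sum_(i < n) f ^+ i.
have SE : (1 - f) * S = 1.
  by rewrite -opprB mulNr -subrX1 fn0 sub0r opprK.
exists S; split=> //; rewrite -[RHS]SE mulrBr mulrBl mulr1 mul1r; congr (_ - _).
by rewrite mulr_suml mulr_sumr; apply: eq_bigr => i _; rewrite -exprS -exprSr.
Qed.

End Fitting.

(** * Finiteness of modules over an Artin algebra *)

(** A submodule of [k ^ I] is determined, among the submodules that contain it,
    by its ideals of leading coefficients, one for each position. *)
Lemma artinian_dcc (k : comPzRingType) (I : finType) (W : nat -> (I -> k) -> Prop) :
  artinian k ->
  (forall t, W t (fun=> 0)) ->
  (forall t c d, W t c -> W t d -> W t (fun i => c i + d i)) ->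
  (forall t a c, W t c -> W t (fun i => a * c i)) ->
  (forall t c, W t.+1 c -> W t c) ->
  exists t0, forall t, (t0 <= t)%N -> forall c, W t0 c -> W t c.
Proof.
move=> art W0 WD WZ Wdec.
have Wmono t u c : (t <= u)%N -> W u c -> W t c.
  move=> /subnKC <-; elim: (u - t)%N c => [|n IHn] c; first by rewrite addn0.
  by rewrite addnS => /Wdec/IHn.
pose J j t (a : k) := exists c, [/\ W t c, c j = a &
  forall i, (enum_rank j < enum_rank i)%N -> c i = 0].
have [st stP] : exists st : I -> nat, forall j t, (st j <= t)%N -> J j t = J j (st j).
  suff /choice[st stP] : forall j, exists m, forall t, (m <= t)%N -> J j t = J j m.
    by exists st.
  move=> j; apply: art => [t|t a [c [Wc cj c0]]]; last by exists c; split=> //; exact: Wdec.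
  split; first by exists (fun=> 0).
  split=> [_ _ [c [Wc <- c0]] [d [Wd <- d0]]|a _ [c [Wc <- c0]]].
    exists (fun i => c i + d i); split=> [||i ij]; [exact: WD | by [] |].
    by rewrite c0 // d0 // addr0.
  exists (fun i => a * c i); split=> [||i ij]; [exact: WZ | by [] |].
  by rewrite c0 // mulr0.
exists (\max_j st j)%N => t le_t c.
have [n nP] : exists n, forall i, (n <= enum_rank i)%N -> c i = 0.
  by exists #|I| => i; rewrite leqNgt ltn_ord.
elim: n c nP => [|n IHn] c cP Wc.
  by rewrite (_ : c = fun=> 0) //; apply/funext => i; exact: cP.
have [ltn|gen] := ltnP n #|I|; last first.
  by apply: IHn => // i le_i; have := leq_trans gen le_i; rewrite leqNgt ltn_ord.
pose j := enum_val (Ordinal ltn); have jE : enum_rank j = n :> nat by rewrite enum_valK.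
have [d [Wd dj d0]] : J j t (c j).
  have stj : (st j <= \max_j st j)%N by exact: leq_bigmax.
  rewrite (stP j t (leq_trans stj le_t)) -(stP j _ stj).
  by exists c; split=> // i; rewrite jE => /cP.
have -> : c = (fun i => d i + (c i + -1 * d i)).
  by apply/funext => i; rewrite mulN1r addrC subrK.
apply: (WD) => //; apply: IHn => [i|]; last first.
  by apply: (WD) => //; apply: (WZ); exact: Wmono Wd.
rewrite leq_eqVlt => /predU1P[ni|lt_i]; last by rewrite cP // d0 ?jE // mulr0 addr0.
suff -> : i = j by rewrite dj mulN1r subrr.
by apply/enum_rank_inj/val_inj; rewrite /= jE.
Qed.

Section ArtinAlgebra.
Variables (k : comPzRingType) (L : algType k).
Hypothesis artL : artin_algebra L.
Variable M : fgmod L^c.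

(** [a%:A] is central in [L], so that multiplication by it is linear: this is the
    [k]-module structure of [M], and composition with it that of [endo M]. *)
Definition scalar_map (a : k) (x : sval M) : sval M := (a%:A : L^c) *: x.

Lemma scalar_map_linear a : linear (scalar_map a).
Proof.
move=> r x y; rewrite /scalar_map scalerDr !scalerA; congr (_ *: _ + _).
by rewrite /GRing.mul /= mulr_algr mulr_algl.
Qed.

HB.instance Definition _ a := GRing.isLinear.Build L^c (sval M) (sval M) *:%R
  (scalar_map a) (scalar_map_linear a).

Definition endo_scalar (a : k) : endo M := (scalar_map a : {linear _ -> _}).

(** An endomorphism of [M] is determined by its values on generators over
    [L^c], and each value has coordinates in [k] because [M] is finitely generated
    over [k].  The coordinates of the members of a [k]-submodule of [endo M] thus
    form a submodule of a power of [k]. *)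
Lemma endo_dcc (V : nat -> endo M -> Prop) :
  (forall t, V t 0) -> (forall t f g, V t f -> V t g -> V t (f + g)) ->
  (forall t a f, V t f -> V t (f * endo_scalar a)) ->
  (forall t f, V t.+1 f -> V t f) ->
  exists t0, forall t, (t0 <= t)%N -> forall f, V t0 f -> V t f.
Proof.
move=> V0 VD VZ Vdec; case: artL => artk [p [b bP]].
case: (proj2_sig M) => m [s sP].
pose val (c : 'I_m * ('I_p * 'I_m) -> k) (x : 'I_m) : sval M :=
  \sum_q (c (x, q) *: b q.1 : L^c) *: s q.2.
pose W t c := exists f : endo M, V t f /\ forall x, f (s x) = val c x.
have [||||t0 t0P] := @artinian_dcc k ('I_m * ('I_p * 'I_m))%type W artk.
- move=> t; exists 0; split=> // x; rewrite /val big1 // => q _.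
  by rewrite scale0r; exact: (scale0r (s q.2)).
- move=> t c d [f [Vf fc]] [g [Vg gd]]; exists (f + g); split; first exact: VD.
  move=> x; rewrite [LHS](_ : _ = f (s x) + g (s x)) // fc gd -big_split.
  apply: eq_bigr => q _; rewrite scalerDl.
  by symmetry; exact: (scalerDl (s q.2) (c (x, q) *: b q.1 : L^c)).
- move=> t a c [f [Vf fc]]; exists (f * endo_scalar a); split; first exact: VZ.
  move=> x; rewrite [LHS](_ : _ = f ((a%:A : L^c) *: s x)) // linearZ fc /=.
  rewrite scaler_sumr; apply: eq_bigr => q _; rewrite scalerA; congr (_ *: _).
  by rewrite /GRing.mul /= mulr_algr scalerA.
- by move=> t c [f [Vf fc]]; exists f; split=> //; exact: Vdec.
exists t0 => t le_t f Vf.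
have [c fc] : exists c, forall x, f (s x) = val c x.
  have /choice[l lP] := fun x => sP (f (s x)).
  have /choice[c cP] := fun xy => bP (l xy.1 xy.2).
  exists (fun q => c (q.1, q.2.2) q.2.1) => x; rewrite lP /val.
  under eq_bigr => y _ do rewrite [l x y](cP (x, y)) scaler_suml.
  by rewrite exchange_big pair_big.
have [//|g [Vg gc]] := t0P t le_t c; first by exists f.
suff -> : f = g by [].
apply: linear_eq => x; have [c' ->] := sP x; rewrite !linear_sum.
by apply: eq_bigr => i _; rewrite !linearZ fc gc.
Qed.

Lemma endo_scalarC a (f : endo M) : f * endo_scalar a = endo_scalar a * f.
Proof. by apply: linear_eq => x; rewrite [LHS]linearZ. Qed.

(** The left ideals and the right ideals generated by the powers of an
    endomorphism form two descending chains of [k]-submodules. *)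
Lemma fitting_fgmod : fitting_object M.
Proof.
move=> f.
have [|||t _ [h ->]|m mP] := @endo_dcc (fun t g => exists h, g = h * f ^+ t).
- by move=> t; exists 0; rewrite mul0r.
- by move=> t _ _ [g ->] [h ->]; exists (g + h); rewrite mulrDl.
- move=> t a _ [h ->]; exists (h * endo_scalar a).
  by rewrite -!mulrA; congr (_ * _); rewrite endo_scalarC.
- by exists (h * f); rewrite exprS mulrA.
have [|||t _ [h ->]|n nP] := @endo_dcc (fun t g => exists h, g = f ^+ t * h).
- by move=> t; exists 0; rewrite mulr0.
- by move=> t _ _ [g ->] [h ->]; exists (g + h); rewrite mulrDr.
- by move=> t a _ [h ->]; exists (h * endo_scalar a); rewrite mulrA.
- by exists (f * h); rewrite exprSr -mulrA.
have [|h hE] := mP m.+1 (leqnSn m) (f ^+ m); first by exists 1; rewrite mul1r.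
have [|g gE] := nP n.+1 (leqnSn n) (f ^+ n); first by exists 1; rewrite mulr1.
apply: (@strongly_pi_regular _ f h g (m + n)).
  by rewrite -addSn !exprD mulrA -hE.
by rewrite -addnS !exprD -mulrA -gE.
Qed.

(** The right ideals generated by the idempotents form a descending chain. *)
Lemma idempotent_dcc_fgmod : idempotent_dcc M.
Proof.
move=> E EP.
have [t|t f g ff gg|t a f ff|t f ff|t tP] := @endo_dcc (fun t f => E t * f = f).
- by rewrite mulr0.
- by rewrite mulrDr ff gg.
- by rewrite mulrA ff.
- by have [_ EE _] := EP t; rewrite -ff mulrA EE.
exists t; have [EtI _ <-] := EP t.
by apply: tP; rewrite ?leqnSn.
Qed.

End ArtinAlgebra.

(** * Splitting idempotents of modules *)

Section FixedPoints.
Variables (R : pzRingType) (M : lmodType R) (e : {linear M -> M}).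

Definition fixed_pred : {pred M} := [pred x | e x == x].

Lemma fixed_pred_submod : submod_closed fixed_pred.
Proof.
split=> [|a x y]; rewrite !inE ?raddf0 // => /eqP ex /eqP ey.
by rewrite linearP ex ey.
Qed.

HB.instance Definition _ :=
  GRing.isSubmodClosed.Build R M fixed_pred fixed_pred_submod.

(** The image of [e], when [e] is idempotent. *)
Record fixed := Fixed {fixed_val : M; _ : fixed_val \in fixed_pred}.

HB.instance Definition _ := [isSub for fixed_val].
HB.instance Definition _ := [Choice of fixed by <:].
HB.instance Definition _ := [SubChoice_isSubLmodule of fixed by <:].

Lemma fixed_val_linear : linear fixed_val.
Proof. exact: linearP (val : fixed -> M). Qed.

HB.instance Definition _ :=
  GRing.isLinear.Build R fixed M *:%R fixed_val fixed_val_linear.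

Lemma fixedE (x : fixed) : e (fixed_val x) = fixed_val x.
Proof. by case: x => x /= /eqP. Qed.

Hypothesis eI : forall x, e (e x) = e x.

Definition fixed_proj (x : M) : fixed := Fixed (introT eqP (eI x)).

Lemma fixed_proj_linear : linear fixed_proj.
Proof. by move=> a x y; apply: val_inj; rewrite /= linearP. Qed.

HB.instance Definition _ :=
  GRing.isLinear.Build R M fixed *:%R fixed_proj fixed_proj_linear.

Lemma fixed_projK x : fixed_proj (fixed_val x) = x.
Proof. by apply: val_inj; exact: fixedE. Qed.

End FixedPoints.

Lemma split_fgmod (R : pzRingType) : split_idempotents (fgmod R).
Proof.
move=> M e eI.
have eIx x : e (e x) = e x by rewrite -[in RHS]eI.
have fgN : fin_gen (fixed e).
  case: (proj2_sig M) => m [s sP]; exists m, (fun i => fixed_proj eIx (s i)) => x.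
  have [c xE] := sP (fixed_val x); exists c.
  rewrite -{1}[x](fixed_projK eIx) xE linear_sum.
  by apply: eq_bigr => i _; rewrite linearZ.
exists (exist _ (fixed e : lmodType R) fgN).
exists (fixed_proj eIx : {linear _ -> _}), (@fixed_val _ _ e : {linear _ -> _}).
by split; apply: linear_eq => x //; exact: fixed_projK.
Qed.

Lemma zero_fgmod0 (R : pzRingType) : pid (fgmod0 R) = 0.
Proof. by apply: linear_eq => v; rewrite [v]thinmx0 !raddf0. Qed.

(** * Semisimple functor categories *)

Section CokernelFunctor.
Import Quotient.
Local Open Scope quotient_scope.
Variables (A : preadditive) (x y : pobj A) (f : phom x y).

Definition image_pred z : {pred phom z y} :=
  [pred b | `[< exists c, b = f \pc c >]].

Arguments image_pred z : clear implicits.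

Lemma image_predP z (b : phom z y) : reflect (exists c, b = f \pc c) (b \in image_pred z).
Proof. exact: asboolP. Qed.

Lemma image_pred_zmod z : zmod_closed (image_pred z).
Proof.
split=> [|_ _ /image_predP[b ->] /image_predP[c ->]]; apply/image_predP.
  by exists 0; rewrite pcomp0r.
by exists (b - c); rewrite pcompBr.
Qed.

HB.instance Definition _ z :=
  GRing.isZmodClosed.Build (phom z y) (image_pred z) (image_pred_zmod z).

Definition coker_obj z : zmodType := {quot image_pred z}.

Definition coker_proj z (b : phom z y) : coker_obj z := \pi_({quot image_pred z}) b.

Lemma coker_projB z : zmod_morphism (@coker_proj z).
Proof. by move=> b c; exact: raddfB. Qed.

HB.instance Definition _ z := GRing.isZmodMorphism.Build (phom z y) (coker_obj z)
  (@coker_proj z) (@coker_projB z).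

Lemma coker_proj_eq0 z (b : phom z y) : coker_proj b = 0 <-> exists c, b = f \pc c.
Proof.
rewrite -(raddf0 (@coker_proj z)); split.
  by move/eqP; rewrite /coker_proj -idealrBE subr0 => /image_predP.
by move=> bE; apply/eqP; rewrite /coker_proj -idealrBE subr0; apply/image_predP.
Qed.

Lemma coker_proj_surj z (a : coker_obj z) : exists b, a = coker_proj b.
Proof. by exists (repr a); rewrite /coker_proj reprK. Qed.

Definition coker_map z w (h : phom z w) (a : coker_obj w) : coker_obj z :=
  coker_proj (repr (a : {quot image_pred w}) \pc h).

Lemma coker_mapE z w (h : phom z w) (b : phom w y) :
  coker_map h (coker_proj b) = coker_proj (b \pc h).
Proof.
apply/eqP; rewrite /coker_map -subr_eq0 -raddfB -pcompBl; apply/eqP/coker_proj_eq0.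
have /image_predP[c ->] : repr (coker_proj b : {quot image_pred w}) - b \in image_pred w.
  by rewrite idealrBE reprK.
by exists (c \pc h); rewrite pcompA.
Qed.

Lemma coker_mapB z w (h : phom z w) : zmod_morphism (coker_map h).
Proof.
move=> a a'; have [[b ->] [b' ->]] := (coker_proj_surj a, coker_proj_surj a').
by rewrite -raddfB !coker_mapE -raddfB pcompBl.
Qed.

HB.instance Definition _ z w (h : phom z w) := GRing.isZmodMorphism.Build
  (coker_obj w) (coker_obj z) (coker_map h) (coker_mapB h).

Definition coker_functor : ab_functor A.
Proof.
apply: (@AbFunctor A coker_obj (fun z w h => coker_map h)).
- by move=> z a; have [b ->] := coker_proj_surj a; rewrite /= coker_mapE pcomp_idr.
- move=> z w t g h a; have [b ->] := coker_proj_surj a.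
  by rewrite /= !coker_mapE pcompA.
- move=> z w g h a; have [b ->] := coker_proj_surj a.
  by rewrite /= !coker_mapE -raddfD pcompDr.
Defined.

Definition coker_trans : nat_trans (representable y) coker_functor.
Proof.
apply: (@NatTrans A (representable y) coker_functor (fun z => @coker_proj z)).
by move=> z w h b; rewrite /= coker_mapE.
Defined.

Definition postcomp z (c : phom z x) : phom z y := f \pc c.

Lemma postcompB z : zmod_morphism (@postcomp z).
Proof. by move=> b c; exact: pcompBr. Qed.

HB.instance Definition _ z := GRing.isZmodMorphism.Build (phom z x) (phom z y)
  (@postcomp z) (@postcompB z).

Definition postcomp_trans : nat_trans (representable x) (representable y).
Proof.
apply: (@NatTrans A (representable x) (representable y) (fun z => @postcomp z)).
by move=> z w h b; rewrite /= /postcomp /precomp pcompA.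
Defined.

Lemma coker_functor_fp : finitely_presented coker_functor.
Proof.
exists x, y, postcomp_trans, coker_trans; split=> [z a|z b].
  exact: coker_proj_surj.
exact: coker_proj_eq0.
Qed.

End CokernelFunctor.

Lemma representable_fp (A : preadditive) (y : pobj A) :
  finitely_presented (representable y).
Proof.
exists y, y, (postcomp_trans (0 : phom y y)), (nt_id _); split=> [z a|z b].
  by exists a.
split=> /= [->|[c ->]]; last by rewrite /postcomp pcomp0l.
by exists 0; rewrite /postcomp pcomp0r.
Qed.

(** If the cokernel of [(-, x) -> (-, y)] is projective, its projection from
    [(-, y)] splits.  By Yoneda, the splitting gives [t : y -> y] with
    [t f = 0] and [1 - t = f g], whence [f = f g f]. *)
Lemma semisimple_regular (A : preadditive) (x y : pobj A) (f : phom x y) :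
  (forall F : mod_category A, projective F) ->
  exists g : phom y x, f = f \pc g \pc f.
Proof.
move=> prF.
pose C : mod_category A := exist _ (coker_functor f) (coker_functor_fp f).
pose Y : mod_category A := exist _ (representable y) (representable_fp y).
pose v : mor Y C := coker_trans f.
have epi_v : epimorphism v.
  move=> F g h ghE; apply: nat_trans_eq => z a.
  have [b ->] := coker_proj_surj a.
  exact: (f_equal (fun n : nat_trans (representable y) (sval F) => n z b) ghE).
have [s sE] := prF C Y C v (idm C) epi_v.
have {}sE z a : coker_proj f (s z a) = a.
  exact: (f_equal (fun n : nat_trans (sval C) (sval C) => n z a) sE).
pose t : phom y y := s y (coker_proj f (pid y)).
have [g gE] : exists g, pid y - t = f \pc g.
  apply/coker_proj_eq0; rewrite raddfB /= (_ : coker_proj f t = coker_proj f (pid y)).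
    by rewrite subrr.
  exact: sE.
have tf0 : t \pc f = 0.
  have := ntransP s f (coker_proj f (pid y)).
  rewrite [fmap _ _ _]coker_mapE pcomp_idl => tfE.
  rewrite -[LHS]tfE (_ : coker_proj f f = 0); first exact: raddf0.
  by apply/coker_proj_eq0; exists (pid x); rewrite pcomp_idr.
by exists g; rewrite -gE pcompBl pcomp_idl tf0 subr0.
Qed.

(** In the stable category this reads [f = f g f], which is von Neumann
    regularity of all morphisms. *)
Lemma stable_regular (R : pzRingType) (G H : fgmod R) (f : phom G H) :
  (forall F : mod_category (stable_gprj R), projective F) ->
  gorenstein_projective G -> gorenstein_projective H ->
  exists g : phom H G, factors_through_projective (f - f \pc g \pc f).
Proof.
Import Quotient.
move=> prF gG gH.
pose G' : pobj (stable_gprj R) := exist _ G gG.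
pose H' : pobj (stable_gprj R) := exist _ H gH.
pose I := projective_ideal R.
pose cls (M N : fgmod R) (h : phom M N) : @phom (stable_fgmod R) M N :=
  \pi_({quot ideal_mem I M N})%qT h.
have [g gE] := @semisimple_regular (stable_gprj R) G' H' (cls G H f) prF.
exists (repr (g : {quot ideal_mem I H G})).
apply/projective_mapsP.
have : cls G H f = cls G H (f \pc repr (g : {quot ideal_mem I H G})%qT \pc f).
  rewrite [LHS]gE -{1}[g](reprK (g : {quot ideal_mem I H G})%qT).
  set r := repr _.
  transitivity (qcomp (I := I) (qcomp (I := I) (cls G H f) (cls H G r)) (cls G H f)) => //.
  have frE := @qcompE (fgmod R) I H G H f r.
  have frfE := @qcompE (fgmod R) I G H H (f \pc r) f.
  exact: etrans (f_equal (fun u => qcomp (I := I) u (cls G H f)) frE) frfE.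
by move/eqP; rewrite /cls -idealrBE.
Qed.

(** * Representations with values in a preadditive category *)

Section Representations.
Variables (Q : quiver) (A : preadditive).
Local Notation rep := (rep_category Q A).
Implicit Types X Y Z : rep.

Definition rep_at X Y (f : mor X Y) v : phom (X v) (Y v) := rep_fun f v.
Definition rep_arr X v w (a : arrow v w) : phom (X v) (X w) := rep_map X a.

Arguments rep_at : simpl never.
Arguments rep_arr : simpl never.

Lemma rep_eq X Y (f g : mor X Y) : (forall v, rep_at f v = rep_at g v) -> f = g.
Proof. by move=> fg; apply: (@rep_hom_eq Q A X Y f g) => v; exact: fg. Qed.

Lemma rep_atP X Y (f : mor X Y) v w (a : arrow v w) :
  rep_at f w \pc rep_arr X a = rep_arr Y a \pc rep_at f v.
Proof. exact: (@rep_homP Q A X Y f v w a). Qed.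

Definition mk_rep X Y (f : forall v, phom (X v) (Y v))
  (fP : forall v w (a : arrow v w), f w \pc rep_arr X a = rep_arr Y a \pc f v) :
  mor X Y := @RepHom Q A X Y f fP.

Lemma rep_at_comp X Y Z (g : mor Y Z) (f : mor X Y) v :
  rep_at (g \oc f) v = rep_at g v \pc rep_at f v.
Proof. by []. Qed.

Lemma rep_at_id X v : rep_at (idm X) v = pid (X v).
Proof. by []. Qed.

Fact rep_zeroP X Y v w (a : arrow v w) :
  (0 : phom (X w) (Y w)) \pc rep_arr X a = rep_arr Y a \pc 0.
Proof. by rewrite pcomp0l pcomp0r. Qed.
Definition rep_zero X Y : mor X Y := mk_rep (@rep_zeroP X Y).

Fact rep_subP X Y (f g : mor X Y) v w (a : arrow v w) :
  (rep_at f w - rep_at g w) \pc rep_arr X a =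
  rep_arr Y a \pc (rep_at f v - rep_at g v).
Proof. by rewrite pcompBl pcompBr !rep_atP. Qed.
Definition rep_sub X Y (f g : mor X Y) : mor X Y := mk_rep (rep_subP f g).

Fact rep_addP X Y (f g : mor X Y) v w (a : arrow v w) :
  (rep_at f w + rep_at g w) \pc rep_arr X a =
  rep_arr Y a \pc (rep_at f v + rep_at g v).
Proof. by rewrite pcompDl pcompDr !rep_atP. Qed.
Definition rep_add X Y (f g : mor X Y) : mor X Y := mk_rep (rep_addP f g).

Lemma rep_zero_objectP X : zero_object X <-> forall v, pid (X v) = 0.
Proof.
split=> [[_ /(_ X)[f [_ fP]]] v|X0].
  by have := f_equal (fun g => rep_at g v) (etrans (esym (fP (idm X) I)) (fP (rep_zero X X) I)).
split=> Y; exists (rep_zero _ _); split=> // f _; apply: rep_eq => v.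
  by symmetry; exact: zero_object_hom0.
by symmetry; exact: hom0_zero_object.
Qed.

Lemma rep_zero_morP (o : pobj A) X Y (f : mor X Y) : pid o = 0 ->
  zero_mor f <-> forall v, rep_at f v = 0.
Proof.
move=> o0; split=> [[Z [/rep_zero_objectP Z0 [g [h ->]]]] v|f0].
  by rewrite rep_at_comp (zero_object_hom0 (rep_at h v) (Z0 v)) pcomp0l.
exists (constant_rep (o : A)); split; first by apply/rep_zero_objectP.
exists (rep_zero _ _), (rep_zero _ _); apply: rep_eq => v.
by rewrite f0 rep_at_comp pcomp0l.
Qed.

(** The vertexwise images of [e] form a subrepresentation. *)
Lemma split_rep X (e : mor X X) : split_idempotents A ->
  (forall v, rep_at e v \pc rep_at e v = rep_at e v) ->
  exists Y (r : mor X Y) (s : mor Y X), forall v,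
    rep_at r v \pc rep_at s v = pid (Y v) /\ rep_at s v \pc rep_at r v = rep_at e v.
Proof.
move=> splitA eI.
have S v : {y : pobj A & {r : phom (X v) y & {s : phom y (X v) |
    r \pc s = pid y /\ s \pc r = rep_at e v}}}.
  by have /cid[y /cid[r /cid[s rs]]] := splitA _ _ (eI v); exists y, r, s.
pose y v := projT1 (S v); pose r v : phom (X v) (y v) := projT1 (projT2 (S v)).
pose s v : phom (y v) (X v) := sval (projT2 (projT2 (S v))).
have [rs sr] : (forall v, r v \pc s v = pid (y v)) /\ (forall v, s v \pc r v = rep_at e v).
  by split=> v; have [] := svalP (projT2 (projT2 (S v))).
pose Y : rep := @QuiverRep Q A y (fun v w a => r w \pc rep_arr X a \pc s v).
have rP v w (a : arrow v w) : r w \pc rep_arr X a = rep_arr Y a \pc r v.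
  rewrite [RHS](_ : _ = r w \pc rep_arr X a \pc s v \pc r v) //.
  by rewrite -[RHS]pcompA sr -[RHS]pcompA -rep_atP -sr !pcompA rs pcomp_idl.
have sP v w (a : arrow v w) : s w \pc rep_arr Y a = rep_arr X a \pc s v.
  rewrite [LHS](_ : _ = s w \pc (r w \pc rep_arr X a \pc s v)) //.
  by rewrite !pcompA sr rep_atP -!pcompA -sr -pcompA rs pcomp_idr.
by exists Y, (@mk_rep X Y r rP), (@mk_rep Y X s sP) => v; split; [exact: rs | exact: sr].
Qed.

Lemma indecomposable_rep_idem X (e : mor X X) : split_idempotents A ->
  indecomposable X -> (forall v, rep_at e v \pc rep_at e v = rep_at e v) ->
  (forall v, rep_at e v = 0) \/ (forall v, rep_at e v = pid (X v)).
Proof.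
move=> splitA [_ XI] ee.
have [Y [r [s rsP]]] := split_rep splitA ee.
have ee' v : rep_at (rep_sub (idm X) e) v \pc rep_at (rep_sub (idm X) e) v =
    rep_at (rep_sub (idm X) e) v.
  exact: (@idem_compl A _ (rep_at e v : endo (X v)) (ee v)).
have [Y' [r' [s' rsP']]] := split_rep splitA ee'.
have P v : [/\ rep_at r v \pc rep_at s' v = 0, rep_at r' v \pc rep_at s v = 0 &
    rep_at s v \pc rep_at r v + rep_at s' v \pc rep_at r' v = pid (X v)].
  have [[? sr] [? ?]] := (rsP v, rsP' v).
  by apply: (@split_complement A _ _ _ (rep_at e v)).
have coprod : is_coproduct s s'.
  move=> T f g; exists (rep_add (f \oc r) (g \oc r')); split.
    split; apply: rep_eq => v.
      have [[rs _] [_ rs0 _]] := (rsP v, P v).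
      rewrite rep_at_comp [RHS]pcompDl !rep_at_comp -!pcompA rs rs0.
      by rewrite pcomp_idr pcomp0r addr0.
    have [[rs _] [rs0 _ _]] := (rsP' v, P v).
    rewrite rep_at_comp [RHS]pcompDl !rep_at_comp -!pcompA rs rs0.
    by rewrite pcomp_idr pcomp0r add0r.
  move=> h [-> ->]; apply: rep_eq => v; have [_ _ sum1] := P v.
  rewrite -[RHS]pcomp_idr -sum1 pcompDr.
  by congr (_ + _); rewrite !rep_at_comp -pcompA.
have [/rep_zero_objectP Y0|/rep_zero_objectP Y0] := XI _ _ _ _ coprod.
  by left=> v; have [_ <-] := rsP v; rewrite (zero_object_hom0 (rep_at s v) (Y0 v)) pcomp0l.
right=> v; have [_ sr'] := rsP' v; apply/eqP; rewrite eq_sym -subr_eq0; apply/eqP.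
by rewrite -[LHS]sr' (zero_object_hom0 (rep_at s' v) (Y0 v)) pcomp0l.
Qed.

Lemma indecomposable_rep_retract X Y (r : mor X Y) (s : mor Y X) v0 :
  split_idempotents A -> indecomposable X -> pid (Y v0) <> 0 ->
  (forall v, rep_at r v \pc rep_at s v = pid (Y v)) ->
  forall v, rep_at s v \pc rep_at r v = pid (X v).
Proof.
move=> splitA XI Y0 rs.
have [v|sr0|//] := @indecomposable_rep_idem X (s \oc r) splitA XI.
  by rewrite rep_at_comp -!pcompA [rep_at r v \pc _]pcompA rs pcomp_idl.
case: Y0; rewrite -rs -[rep_at r v0]pcomp_idl -rs -!pcompA [rep_at s v0 \pc _]pcompA.
by have := sr0 v0; rewrite rep_at_comp => ->; rewrite pcomp0l pcomp0r.
Qed.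

Lemma rep_iso_isomorphic X Y (r : mor X Y) (s : mor Y X) :
  (forall v, rep_at r v \pc rep_at s v = pid (Y v)) ->
  (forall v, rep_at s v \pc rep_at r v = pid (X v)) -> isomorphic X Y.
Proof. by move=> rs sr; exists r, s; split; apply: rep_eq. Qed.

End Representations.

(** * Representations of the linear quiver *)

Lemma ord_down_ind n (P : 'I_n -> Prop) (w : 'I_n) : P w ->
  (forall v v' : 'I_n, v.+1 = v' :> nat -> (v' <= w)%N -> P v' -> P v) ->
  forall v : 'I_n, (v <= w)%N -> P v.
Proof.
move=> Pw step v; move dE: (w - v)%N => d.
elim: d v dE => [|d IHd] v dE le_vw.
  by rewrite (_ : v = w) //; apply: val_inj => /=; lia.
have lt_n : (v.+1 < n)%N by have := ltn_ord w; lia.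
by apply: (step v (Ordinal lt_n)) => //=; [lia | apply: IHd => /=; lia].
Qed.

Lemma ord_up_ind n (P : 'I_n -> Prop) (w : 'I_n) : P w ->
  (forall v v' : 'I_n, v.+1 = v' :> nat -> (w <= v)%N -> P v -> P v') ->
  forall v : 'I_n, (w <= v)%N -> P v.
Proof.
move=> Pw step v; move dE: (v - w)%N => d.
elim: d v dE => [|d IHd] v dE le_vw.
  by rewrite (_ : v = w) //; apply: val_inj => /=; lia.
have lt_n : (v.-1 < n)%N by have := ltn_ord v; lia.
by apply: (step (Ordinal lt_n) v) => /=; [lia | lia | apply: IHd => /=; lia].
Qed.

Section LinearQuiver.
Variables (A : preadditive) (n : nat).
Local Notation Q := (linear_quiver n).
Local Notation rep := (rep_category Q A).
Implicit Types (X Y Z : rep) (u v w : 'I_n).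

(** Zero unless [w] is [v + d], so that no proof of [v <= w] has to be carried. *)
Fixpoint path_rec X d v w : phom (X v) (X w) :=
  if d is d'.+1 then
    match @idP (v.+1 < n)%N with
    | ReflectT lt_n =>
        path_rec X d' (Ordinal lt_n) w \pc
        @rep_arr Q A X v (Ordinal lt_n) (erefl : v.+1 = Ordinal lt_n :> nat)
    | _ => 0
    end
  else match v =P w with
    | ReflectT vw =>
        match vw in _ = u return phom (X v) (X u) with erefl => pid (X v) end
    | _ => 0
    end.

Definition path_map X v w : phom (X v) (X w) := path_rec X (w - v) v w.

Lemma path_id X v : path_map X v v = pid (X v).
Proof.
by rewrite /path_map subnn /=; case: eqP => // vv; rewrite (eq_axiomK vv).
Qed.

Lemma path_cons X v v' w (a : @arrow Q v v') : (v' <= w)%N ->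
  path_map X v w = path_map X v' w \pc rep_arr X a.
Proof.
case: v' a => m lt_m /= a; change (v.+1 = m) in a; subst m => le_w.
rewrite /path_map (_ : (w - v)%N = (w - v.+1).+1)%N /=; last by lia.
case: {-}_ / idP => [lt_n|]; last by rewrite lt_m.
by rewrite (bool_irrelevance lt_n lt_m).
Qed.

Lemma path_rcons X v w w' (a : @arrow Q w w') : (v <= w)%N ->
  path_map X v w' = rep_arr X a \pc path_map X v w.
Proof.
move: v; have ww' : w.+1 = w' :> nat := a.
apply: ord_down_ind => [|v v' vv' le_w IHv].
  by rewrite path_id (path_cons X a) // path_id pcomp_idl pcomp_idr.
rewrite (@path_cons X v v' w' vv') ?IHv; last by lia.
by rewrite -pcompA -(@path_cons X v v' w vv').
Qed.

Lemma path_comp X u v w : (u <= v)%N -> (v <= w)%N ->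
  path_map X v w \pc path_map X u v = path_map X u w.
Proof.
move=> le_uv; move: w; apply: ord_up_ind => [|w w' ww' le_w IHw].
  by rewrite path_id pcomp_idl.
rewrite (@path_rcons X v w w' ww') // (@path_rcons X u w w' ww') -?IHw ?pcompA //.
exact: leq_trans le_uv le_w.
Qed.

Lemma path_nat X Y (f : mor X Y) v w : (v <= w)%N ->
  rep_at f w \pc path_map X v w = path_map Y v w \pc rep_at f v.
Proof.
move: w; apply: ord_up_ind => [|w w' ww' le_w IHw].
  by rewrite !path_id pcomp_idl pcomp_idr.
rewrite !(@path_rcons _ v w w' ww') // pcompA rep_atP -!pcompA.
by rewrite IHw.
Qed.

Lemma path_const (q : A) v w : (v <= w)%N ->
  path_map (constant_rep q : rep) v w = pid q.
Proof.
move: w; apply: ord_up_ind => [|w w' ww' le_w IHw]; first exact: path_id.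
by rewrite (@path_rcons _ v w w' ww') // IHw [LHS](@pcomp_idl A).
Qed.

Lemma rep_epi X Y (e : mor X Y) :
  (forall v, epimorphism (rep_at e v : mor (X v) (Y v))) -> epimorphism e.
Proof.
move=> epi_e Z g h ghE; apply: rep_eq => v; apply: (epi_e v).
exact: (f_equal (fun f => rep_at f v) ghE).
Qed.

(** The hypotheses say that [U] represents the functor [Y |-> Hom(q, Y v)], which
    preserves epimorphisms when evaluation at [v] does and [q] is projective. *)
Lemma free_projective (q : A) (U : rep) v (u : phom q (U v)) :
  (forall Y (g : phom q (Y v)), exists G : mor U Y, rep_at G v \pc u = g) ->
  (forall Y (G G' : mor U Y), rep_at G v \pc u = rep_at G' v \pc u -> G = G') ->
  (forall Y Z (e : mor Y Z), epimorphism e ->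
     epimorphism (rep_at e v : mor (Y v) (Z v))) ->
  projective q -> projective U.
Proof.
move=> ext uniq ev_epi prq Y Z e f epi_e.
have [g gE] := prq _ _ _ (rep_at f v \pc u : mor q (Z v)) (ev_epi _ _ _ epi_e).
have [G GE] := ext Y g; exists G; apply: uniq.
by rewrite rep_at_comp -pcompA GE; exact: gE.
Qed.

Section Brackets.
Variables (o : pobj A) (o0 : pid o = 0).

(** The right adjoint of evaluation at [v] : [q] on the vertices up to [v]. *)
Definition coind v (q : A) : rep := bracket_rep o (0 : phom q o) n 1 v.+1.

(** The left adjoint of evaluation at [v] : [q] on the vertices from [v] on. *)
Definition ind v (q : A) : rep := bracket_rep o (0 : phom o q) n 1 v.

Lemma block_of1 j v : block_of 1 j v.+1 = if (v < j)%N then BlockK else BlockP.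
Proof. by []. Qed.

(** Morphisms into and out of a bracket representation are given by families
    over all blocks [b], although only the block of the vertex [w] matters at [w]:
    the block of [w] can then be computed by rewriting. *)
Definition coind_fun X v (q : A) (h : phom (X v) q) w b :
    phom (X w) (block_obj o q o b) :=
  match b with BlockK => h \pc path_map X w v | _ => 0 end.

Fact coind_funP X v (q : A) (h : phom (X v) q) w w' (a : @arrow Q w w') :
  coind_fun h w' (block_of 1 v.+1 w'.+1) \pc rep_arr X a =
  block_map o (0 : phom q o) (block_of 1 v.+1 w.+1) (block_of 1 v.+1 w'.+1) \pc
    coind_fun h w (block_of 1 v.+1 w.+1).
Proof.
have ww' : w.+1 = w' :> nat := a.
rewrite !block_of1.
case: (ltnP w' v.+1) => /= w'v; last first.
  by rewrite [LHS]hom0_zero_object // [RHS]hom0_zero_object.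
rewrite (_ : (w < v.+1)%N = true) /=; last by lia.
by rewrite -pcompA -path_cons // pcomp_idl.
Qed.

Definition coind_hom X v (q : A) (h : phom (X v) q) : mor X (coind v q) :=
  @mk_rep Q A X (coind v q) _ (coind_funP h).

Definition coind_map_fun (x y : pobj A) (e : phom x y) b :
    phom (block_obj o x o b) (block_obj o y o b) :=
  match b with BlockK => e | _ => 0 end.

Fact coind_mapP (x y : A) (e : phom x y) v w w' (a : @arrow Q w w') :
  coind_map_fun e (block_of 1 v.+1 w'.+1) \pc
    block_map o (0 : phom x o) (block_of 1 v.+1 w.+1) (block_of 1 v.+1 w'.+1) =
  block_map o (0 : phom y o) (block_of 1 v.+1 w.+1) (block_of 1 v.+1 w'.+1) \pc
    coind_map_fun e (block_of 1 v.+1 w.+1).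
Proof.
case: (block_of 1 v.+1 w.+1) => /=; rewrite ?pcomp0r ?pcomp0l //.
  by case: block_of; rewrite /= ?pcomp0l ?pcomp0r ?pcomp_idl ?pcomp_idr.
by case: block_of; rewrite /= ?pcomp0l ?pcomp0r ?pcomp_idl ?pcomp_idr.
Qed.

Definition coind_map (x y : A) (e : phom x y) v : mor (coind v x) (coind v y) :=
  @mk_rep Q A (coind v x) (coind v y) _ (@coind_mapP x y e v).

(** The identification of [coind v q] with [q] at the vertex [v]. *)
Definition coind_ev (q : pobj A) b : phom (block_obj o q o b) q :=
  match b with BlockK => pid q | _ => 0 end.

Lemma coind_block v : block_of 1 v.+1 v.+1 = BlockK.
Proof. by rewrite block_of1 ltnSn. Qed.

Lemma coind_funE X v (q : A) (h : phom (X v) q) :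
  coind_ev q (block_of 1 v.+1 v.+1) \pc coind_fun h v (block_of 1 v.+1 v.+1) = h.
Proof. by rewrite coind_block /= path_id pcomp_idl pcomp_idr. Qed.

(** Evaluation at [v] is a left adjoint. *)
Lemma epimorphism_at X Y (e : mor X Y) v :
  epimorphism e -> epimorphism (rep_at e v : mor (X v) (Y v)).
Proof.
move=> epi_e; apply/epiP => q g ge0.
have E : coind_hom g \oc e = rep_zero _ _ \oc e.
  apply: rep_eq => w; rewrite !rep_at_comp pcomp0l.
  change (coind_fun g w (block_of 1 v.+1 w.+1) \pc rep_at e w = 0).
  rewrite block_of1; case: ltnP => /= w_v; last by rewrite pcomp0l.
  by rewrite -pcompA -path_nat // pcompA ge0 pcomp0l.
rewrite -[LHS]coind_funE [coind_fun _ _ _](_ : _ = rep_at (coind_hom g) v) //.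
by rewrite (epi_e _ _ _ E) pcomp0r.
Qed.

(** The right adjoint [coind v] of evaluation preserves epimorphisms. *)
Lemma projective_at (U : rep) v : projective U -> projective (U v : A).
Proof.
move=> prU x y e f epi_e.
have epi_b b z (g : phom (block_obj o y o b) z) : g \pc coind_map_fun e b = 0 -> g = 0.
  by case: b g => /= g; [move=> _; exact: zero_object_hom0 | exact: (proj1 (epiP e) epi_e z g) |
    move=> _; exact: zero_object_hom0].
have epi_ce : epimorphism (coind_map e v).
  by apply: rep_epi => w; apply/epiP => z; exact: epi_b.
have [g gE] := prU _ _ _ (coind_hom f) epi_ce.
have {}gE : coind_map_fun e (block_of 1 v.+1 v.+1) \pc rep_at g v =
    coind_fun f v (block_of 1 v.+1 v.+1).
  exact: (f_equal (fun h : mor U (coind v y) => rep_at h v) gE).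
have evE b : coind_ev y b \pc coind_map_fun e b = e \pc coind_ev x b.
  by case: b; rewrite /= ?pcomp0l ?pcomp0r ?pcomp_idl ?pcomp_idr.
exists (coind_ev x (block_of 1 v.+1 v.+1) \pc rep_at g v).
by rewrite [LHS]pcompA -evE -pcompA gE coind_funE.
Qed.

Definition ind_fun X v (q : A) (h : phom q (X v)) w b :
    phom (block_obj o o q b) (X w) :=
  match b with BlockP => path_map X v w \pc h | _ => 0 end.

Fact ind_funP X v (q : A) (h : phom q (X v)) w w' (a : @arrow Q w w') :
  ind_fun h w' (block_of 1 v w'.+1) \pc
    block_map o (0 : phom o q) (block_of 1 v w.+1) (block_of 1 v w'.+1) =
  rep_arr X a \pc ind_fun h w (block_of 1 v w.+1).
Proof.
have ww' : w.+1 = w' :> nat := a.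
rewrite !block_of1.
case: (ltnP w v) => /= w_v; first by rewrite pcomp0r; exact: zero_object_hom0.
rewrite ltnNge -ww' leqW //= pcomp_idr (@path_rcons X v w w' a) //.
by rewrite pcompA.
Qed.

Definition ind_hom X v (q : A) (h : phom q (X v)) : mor (ind v q) X :=
  @mk_rep Q A (ind v q) X _ (ind_funP h).

Definition ind_inc (q : pobj A) b : phom q (block_obj o o q b) :=
  match b with BlockP => pid q | _ => 0 end.

(** The universal map from [q] to [ind v q] at the vertex [v]. *)
Definition ind_gen v (q : A) : phom q (ind v q v) := ind_inc q (block_of 1 v v.+1).

Lemma ind_block v : block_of 1 v v.+1 = BlockP.
Proof. by rewrite block_of1 ltnn. Qed.

Lemma ind_funE X v (q : A) (h : phom q (X v)) :
  rep_at (ind_hom h) v \pc ind_gen v q = h.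
Proof.
change (ind_fun h v (block_of 1 v v.+1) \pc ind_inc q (block_of 1 v v.+1) = h).
by rewrite ind_block /= path_id pcomp_idl pcomp_idr.
Qed.

Lemma ind_hom_uniq X v (q : A) (G G' : mor (ind v q) X) :
  rep_at G v \pc ind_gen v q = rep_at G' v \pc ind_gen v q -> G = G'.
Proof.
move=> GG'; apply: rep_eq => w.
have [w_v|v_w] := ltnP w v.
  have: pid (ind v q w) = 0 by rewrite /ind /= block_of1 w_v.
  by move=> Iw; rewrite [LHS]zero_object_hom0 // [RHS]zero_object_hom0.
have E : rep_at G w \pc ind_inc q (block_of 1 v w.+1) =
         rep_at G' w \pc ind_inc q (block_of 1 v w.+1).
  move: w v_w; apply: ord_up_ind => // w w' ww' v_w IHw.
  have E : ind_inc q (block_of 1 v w'.+1) =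
      @rep_arr Q A (ind v q) w w' ww' \pc ind_inc q (block_of 1 v w.+1).
    change (ind_inc q (block_of 1 v w'.+1) =
      block_map o (0 : phom o q) (block_of 1 v w.+1) (block_of 1 v w'.+1) \pc
      ind_inc q (block_of 1 v w.+1)).
    rewrite !block_of1 !ltnNge v_w -ww' leqW //=.
    by rewrite pcomp_idl.
  by rewrite E !pcompA !rep_atP -!pcompA IHw.
have B : block_of 1 v w.+1 = BlockP by rewrite block_of1 ltnNge v_w.
have incK : ind_inc q (block_of 1 v w.+1) \pc
    (match block_of 1 v w.+1 as b return phom (block_obj o o q b) q with
     | BlockP => pid q | _ => 0 end) = pid (ind v q w).
  by rewrite /ind /= B /= pcomp_idl.
by rewrite -[LHS]pcomp_idr -[RHS]pcomp_idr -incK !pcompA E.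
Qed.

Lemma ind_projective v (q : A) : projective q -> projective (ind v q).
Proof.
apply: (@free_projective q (ind v q) v (ind_gen v q)) => [Y g|Y G G'|Y Z e].
- by exists (ind_hom g); exact: ind_funE.
- exact: ind_hom_uniq.
- exact: epimorphism_at.
Qed.

(** [constant_rep q] is freely generated by [q] placed at the first vertex. *)
Lemma constant_projective (v0 : 'I_n) (q : A) :
  v0 = 0%N :> nat -> projective q -> projective (constant_rep q : rep).
Proof.
move=> v00; have v0_le w : (v0 <= w)%N by rewrite v00.
apply: (@free_projective q (constant_rep q) v0 (pid q)) => [Y g|Y G G'|Y Z e].
- have gP w w' (a : @arrow Q w w') : (path_map Y v0 w' \pc g) \pc
      rep_arr (constant_rep q : rep) a = rep_arr Y a \pc (path_map Y v0 w \pc g).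
    rewrite (@path_rcons Y v0 w w' a) // -!pcompA; congr (_ \pc (_ \pc _)).
    exact: (@pcomp_idr A).
  by exists (@mk_rep Q A (constant_rep q) Y _ gP); rewrite /rep_at /= path_id pcomp_idl pcomp_idr.
- rewrite !pcomp_idr => GG'; apply: rep_eq => w.
  have := path_nat G (v0_le w); rewrite path_const // pcomp_idr => ->.
  by have := path_nat G' (v0_le w); rewrite path_const // pcomp_idr => ->; rewrite GG'.
- exact: epimorphism_at.
Qed.

End Brackets.

End LinearQuiver.

(** * Gorenstein projective representations *)

Lemma exact_at_comp (A : preadditive) (o x y z : pobj A) (f : phom x y) (g : phom y z) :
  pid o = 0 -> exact_at (f : mor (x : A) y) (g : mor (y : A) z) -> g \pc f = 0.
Proof.
move=> /zero_objectP o0 [k [i [e [/(kernelP o0)[gi0 _ _] [_ fE]]]]].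
by rewrite [f]fE [LHS]pcompA gi0 pcomp0l.
Qed.

Section GorensteinProjective.
Variables (A : preadditive) (n : nat) (o : pobj A) (o0 : pid o = 0).
Local Notation Q := (linear_quiver n).
Local Notation rep := (rep_category Q A).
Implicit Types (X Y Z : rep) (u v w : 'I_n).

(** Evaluation at [v] is a right adjoint. *)
Lemma kernel_at X Y Z (i : mor X Y) (g : mor Y Z) v :
  is_kernel i g -> is_kernel (rep_at i v : mor (X v) (Y v)) (rep_at g v : mor (Y v) (Z v)).
Proof.
move=> [/(rep_zero_morP _ o0) gi0 iP]; apply/(kernelP (proj2 (zero_objectP o) o0)).
have {}gi0 w : rep_at g w \pc rep_at i w = 0 := gi0 w.
split=> // [t u gu0|t u iu0].
  have [|y [yE _]] := iP _ (ind_hom o0 (u : phom t (Y v))).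
    apply/(rep_zero_morP _ o0) => w.
    change (rep_at g w \pc ind_fun o u w (block_of 1 v w.+1) = 0).
    rewrite block_of1; case: ltnP => /= v_w; first by rewrite pcomp0r.
    by rewrite pcompA path_nat // -pcompA gu0 pcomp0r.
  exists (rep_at y v \pc ind_gen o v t).
  by rewrite -[LHS](ind_funE o0) yE rep_at_comp pcompA.
have [|y [yE yU]] := iP _ (i \oc ind_hom o0 (u : phom t (X v))).
  by apply/(rep_zero_morP _ o0) => w; rewrite !rep_at_comp pcompA gi0 pcomp0l.
have y0 : y = ind_hom o0 (u : phom t (X v)) by exact: (yU _ erefl).
have y0' : y = rep_zero _ _.
  apply: yU; apply: rep_eq => w; rewrite !rep_at_comp pcomp0r.
  change (rep_at i w \pc ind_fun o u w (block_of 1 v w.+1) = 0).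
  rewrite block_of1; case: ltnP => /= v_w; first by rewrite pcomp0r.
  by rewrite pcompA path_nat // -pcompA iu0 pcomp0r.
by rewrite -[LHS](ind_funE o0) -y0 y0' pcomp0l.
Qed.

Lemma exact_at_at X Y Z (f : mor X Y) (g : mor Y Z) v : exact_at f g ->
  exact_at (rep_at f v : mor (X v) (Y v)) (rep_at g v : mor (Y v) (Z v)).
Proof.
move=> [K [i [e [kerP [epi_e ->]]]]]; exists (K v), (rep_at i v), (rep_at e v).
by split; [exact: kernel_at | split=> //; exact: (epimorphism_at o0)].
Qed.

Section Complex.
Variables (P : int -> rep) (d : forall i, mor (P i) (P (i + 1))).
Hypotheses (prP : forall i, projective (P i)) (acP : acyclic d)
  (homP : forall q, projective q -> hom_acyclic d q).

Lemma complex_at (i : int) v : rep_at (d (i + 1)) v \pc rep_at (d i) v = 0.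
Proof. exact: (exact_at_comp o0 (exact_at_at v (acP i))). Qed.

(** The functor [Hom(-, coind v q)] is exact on the complex although
    [coind v q] need not be projective, because it has the projective resolution
    [0 -> ind (v + 1) q -> constant_rep q -> coind v q -> 0]. *)
Lemma complex_extension (i : int) v (q : A) (h : phom (P (i + 1 + 1) v) q) :
  projective q -> h \pc rep_at (d (i + 1)) v = 0 ->
  exists t : mor (P (i + 1 + 1 + 1)) (constant_rep q),
    h = rep_at t v \pc rep_at (d (i + 1 + 1)) v.
Proof.
move=> prq hd0.
have n_gt0 : (0 < n)%N by apply: leq_ltn_trans (ltn_ord v).
have prC : projective (constant_rep q : rep).
  exact: (@constant_projective A n o o0 (Ordinal n_gt0)).
have epi_p : epimorphism (coind_hom o0 (pid q : phom ((constant_rep q : rep) v) q)).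
  apply: rep_epi => w; apply/epiP => z.
  have epi_b b (g : phom (block_obj o q o b) z) : (b = BlockK -> (w <= v)%N) ->
    g \pc coind_fun o (pid q : phom ((constant_rep q : rep) v) q) w b = 0 -> g = 0.
    case: b g => /= g w_v; [by move=> _; exact: zero_object_hom0 | |
      by move=> _; exact: zero_object_hom0].
    by rewrite path_const ?pcomp_idr; last exact: w_v.
  move=> g; apply: epi_b; rewrite block_of1.
  by case: ltnP.
(* lift h to t, then correct t by a morphism s' that factors through
   ind (v + 1) q, so that t - s' vanishes on the boundaries and still restricts
   to h at v *)
have [t tE] := @prP _ _ _ _ (coind_hom o0 h) epi_p.
have {tE} th : rep_at t v = h.
  have tEv : coind_fun o (pid q : phom ((constant_rep q : rep) v) q) v
      (block_of 1 v.+1 v.+1) \pc rep_at t v = coind_fun o h v (block_of 1 v.+1 v.+1).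
    exact: (f_equal (fun h : mor _ (coind o v q) => rep_at h v) tE).
  by rewrite -[RHS](coind_funE o) -tEv pcompA (coind_funE o) pcomp_idl.
have [s sE] : exists s, s = t \oc d (i + 1) by exists (t \oc d (i + 1)).
have s0 w : (w <= v)%N -> rep_at s w = 0.
  move=> w_v; have := path_nat s w_v; rewrite path_const // pcomp_idl => <-.
  by rewrite sE rep_at_comp th hd0 pcomp0l.
have [s' [s'v s'E]] : exists s' : mor (P (i + 1 + 1)) (constant_rep q),
    rep_at s' v = 0 /\ forall w, rep_at s' w \pc rep_at (d (i + 1)) w = rep_at s w.
  have [lt_n|gt_n] := ltnP v.+1 n; last first.
    exists (rep_zero _ _); split=> // w; rewrite pcomp0l s0 //.
    by have := ltn_ord w; lia.
  pose v1 : 'I_n := Ordinal lt_n.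
  pose s1f w b : phom (P (i + 1) w) (block_obj o o q b) :=
    match b with BlockP => rep_at s w | _ => 0 end.
  have s1P w w' (a : @arrow Q w w') : s1f w' (block_of 1 v1 w'.+1) \pc
      rep_arr (P (i + 1)) a =
      block_map o (0 : phom o q) (block_of 1 v1 w.+1) (block_of 1 v1 w'.+1) \pc
      s1f w (block_of 1 v1 w.+1).
    have ww' : w.+1 = w' :> nat := a; rewrite !block_of1 /s1f.
    case: (ltnP w' v1) => /= w'v.
      by rewrite [LHS]hom0_zero_object // [RHS]hom0_zero_object.
    have sP : rep_at s w' \pc rep_arr (P (i + 1)) a = rep_at s w.
      by rewrite rep_atP; exact: (@pcomp_idl A).
    rewrite [LHS]sP.
    case: (ltnP w v1) => /= w_v; first by rewrite pcomp0l s0.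
    by rewrite pcomp_idl.
  pose s1 : mor (P (i + 1)) (ind o v1 q) := @mk_rep Q A _ (ind o v1 q) _ s1P.
  have [|s2 s2E] := homP (ind_projective o0 (v := v1) prq) (i := i) (h := s1).
    apply/(rep_zero_morP _ o0) => w; rewrite rep_at_comp.
    change (s1f w (block_of 1 v1 w.+1) \pc rep_at (d i) w = 0).
    rewrite block_of1; case: ltnP => /= w_v; first by rewrite pcomp0l.
    by rewrite sE rep_at_comp -pcompA complex_at pcomp0r.
  exists (ind_hom o0 (pid q : phom q ((constant_rep q : rep) v1)) \oc s2); split.
    rewrite rep_at_comp.
    have iv0 : rep_at (ind_hom o0 (pid q : phom q ((constant_rep q : rep) v1))) v = 0.
      apply: zero_object_hom0; change (pid (block_obj o o q (block_of 1 v1 v.+1)) = 0).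
      by rewrite block_of1 ltnSn.
    by rewrite iv0 pcomp0l.
  move=> w; rewrite rep_at_comp -pcompA -rep_at_comp -s2E.
  change (ind_fun o (pid q : phom q ((constant_rep q : rep) v1)) w (block_of 1 v1 w.+1)
    \pc s1f w (block_of 1 v1 w.+1) = rep_at s w).
  rewrite block_of1; case: ltnP => /= w_v; first by rewrite pcomp0l s0.
  by rewrite path_const // pcomp_idl [LHS]pcomp_idl.
have [|t' t'E] := homP prC (i := i + 1) (h := rep_sub t s').
  apply/(rep_zero_morP _ o0) => w; rewrite rep_at_comp.
  change ((rep_at t w - rep_at s' w) \pc rep_at (d (i + 1)) w = 0).
  by rewrite pcompBl s'E sE rep_at_comp subrr.
exists t'; rewrite -rep_at_comp -t'E.
by change (h = rep_at t v - rep_at s' v); rewrite s'v subr0.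
Qed.

End Complex.

Lemma int_succ3 (i : int) : exists j, i = j + 1 + 1 + 1.
Proof. by exists (i - 3); lia. Qed.

Lemma gorenstein_projective_at X v :
  gorenstein_projective X -> gorenstein_projective (X v : A).
Proof.
move=> [P [d [prP [acP [homP [i [k kP]]]]]]].
exists (fun i => P i v), (fun i => rep_at (d i) v).
split; first by move=> j; apply: (projective_at o0).
split; first by move=> j; exact: exact_at_at.
split; last by exists i, (rep_at k v); exact: kernel_at.
move=> q prq j; have [l ->] : exists l, j = l + 1 by exists (j - 1); lia.
move=> h /(zero_morP (proj2 (zero_objectP o) o0)) hd0.
have [t tE] := complex_extension prP acP homP prq hd0.
by exists (rep_at t v).
Qed.

(** The map [h] corresponds to a morphism from [X] to [coind v q], which lifts
    to [constant_rep q] because [Ext^1(X, ind (v + 1) q) = 0]. *)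
Lemma gorenstein_projective_extension X v (q : A) (h : phom (X v) q) :
  gorenstein_projective X -> projective q ->
  exists t : mor X (constant_rep q), rep_at t v = h.
Proof.
move=> [P [d [prP [acP [homP [i]]]]]].
have [j ->] := int_succ3 i; move=> [k kP] prq.
have [K [k' [e [k'P [epi_e dE]]]]] := acP (j + 1 + 1).
have [g [gE _]] : exists! g : mor X K, k = k' \oc g by apply k'P; case: kP.
have [g' [g'E _]] : exists! g' : mor K X, k' = k \oc g' by apply kP; case: k'P.
have kK : is_kernel (rep_at k v : mor (X v) _) (rep_at (d (j + 1 + 1 + 1)) v : mor (P _ v) _).
  exact: kernel_at.
have [|t tE] := @complex_extension P d prP acP homP j v q
  (h \pc rep_at g' v \pc rep_at e v) prq.
  have dd := complex_at acP (j + 1) v.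
  rewrite -!pcompA; suff -> : rep_at g' v \pc (rep_at e v \pc rep_at (d (j + 1)) v) = 0.
    by rewrite pcomp0r.
  have [_ _ k_inj] := proj1 (kernelP (proj2 (zero_objectP o) o0) _ _) kK.
  apply: k_inj; rewrite -dd dE !rep_at_comp !pcompA; congr (_ \pc _ \pc _).
  by rewrite -rep_at_comp -g'E.
exists (t \oc k); rewrite rep_at_comp.
have epi_ev := epimorphism_at o0 (v := v) epi_e.
have g'g : rep_at g' v \pc rep_at g v = pid (X v).
  rewrite -rep_at_comp -rep_at_id (_ : g' \oc g = idm X) //.
  have [u [_ uU]] : exists! u : mor X X, k = k \oc u by apply kP; case: kP.
  rewrite -(uU (g' \oc g)) ?compA -?g'E //.
  by rewrite -(uU (idm X)) ?comp_idr.
have E : rep_at t v \pc rep_at k' v = h \pc rep_at g' v.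
  apply: epi_ev; rewrite [RHS]tE dE rep_at_comp.
  exact: esym (pcompA _ _ _).
by rewrite gE rep_at_comp pcompA E -pcompA g'g pcomp_idr.
Qed.

(** The maps of [X] are monomorphisms with Gorenstein projective cokernels; this
    is the consequence of that fact on which the classification rests. *)
Lemma gorenstein_projective_path_extension X v w (q : A) (h : phom (X v) q) :
  gorenstein_projective X -> projective q -> (v <= w)%N ->
  exists h' : phom (X w) q, h' \pc path_map X v w = h.
Proof.
move=> gX prq v_w; have [t tE] := gorenstein_projective_extension h gX prq.
exists (rep_at t w); rewrite (path_nat t v_w) path_const // tE.
exact: pcomp_idl.
Qed.

End GorensteinProjective.

(** * Totally acyclic complexes *)

Section Cosyzygy.
Variables (A : preadditive) (o : pobj A) (o0 : pid o = 0).
Hypothesis splitA : split_idempotents A.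

Let kerP := @kernelP A o (proj2 (zero_objectP o) o0).
Let zmP := @zero_morP A o (proj2 (zero_objectP o) o0).

Section Complex.
Variables (P : int -> pobj A) (d : forall i : int, phom (P i) (P (i + 1))).
Hypotheses (prP : forall i, projective (P i : A))
  (acP : acyclic (d : forall i : int, mor (P i : A) (P (i + 1))))
  (homP : forall q : A, projective q ->
     hom_acyclic (d : forall i : int, mor (P i : A) (P (i + 1))) q).

Lemma complex_comp (i : int) : d (i + 1) \pc d i = 0.
Proof. exact: (exact_at_comp o0 (acP i)). Qed.

Lemma complex_hom (i : int) (q : A) (h : phom (P (i + 1)) q) :
  projective q -> h \pc d i = 0 -> exists h' : phom (P (i + 1 + 1)) q, h = h' \pc d (i + 1).
Proof. by move=> prq hd; apply: (homP prq); apply/zmP. Qed.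

(** [f], composed with the epimorphism from the preceding term onto the kernel,
    is a cocycle of [Hom(P, q)], hence a coboundary. *)
Lemma kernel_extension (i : int) a (k : phom a (P (i + 1 + 1))) (q : A) (f : phom a q) :
  is_kernel (k : mor (a : A) (P _)) (d (i + 1 + 1)) -> projective q ->
  exists g : phom (P (i + 1 + 1)) q, f = g \pc k.
Proof.
move=> /kerP[dk0 kP k_inj] prq.
have [K [k' [e [/kerP[dk'0 k'P _] [epi_e dE]]]]] := acP (i + 1).
change (d (i + 1) = (k' : phom K _) \pc e) in dE.
have [u kE] := k'P _ _ dk0; have [v k'E] := kP _ _ dk'0.
have vu : v \pc u = pid a.
  apply/eqP; rewrite -subr_eq0; apply/eqP/k_inj.
  by rewrite pcompBr pcompA -k'E -kE pcomp_idr subrr.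
have [|g gE] := @complex_hom i q (f \pc v \pc e) prq.
  have ed0 : (v \pc e) \pc d i = 0.
    by apply: k_inj; rewrite !pcompA -k'E -dE complex_comp.
  by rewrite -!pcompA [v \pc _]pcompA ed0 pcomp0r.
exists g; have fvE : f \pc v = g \pc k'.
  by apply: epi_e; rewrite [LHS]gE dE; exact: pcompA.
by rewrite kE pcompA -fvE -pcompA vu pcomp_idr.
Qed.

(** The image of the idempotent chain map [E] is a direct summand of the complex,
    so it is again totally acyclic, and [b] is a kernel in it. *)
Lemma summand_gorenstein_projective (E : forall i, endo (P i)) :
  (forall i, E i * E i = E i) ->
  (forall i : int, E (i + 1) \pc d i = d i \pc E i) ->
  forall (i : int) a b (k : phom a (P i)) (e : endo a) (r : phom a b) (s : phom b a),
  is_kernel (k : mor (a : A) (P i)) (d i) -> k \pc e = E i \pc k ->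
  r \pc s = pid b -> s \pc r = e -> gorenstein_projective (b : A).
Proof.
move=> EI Ed i a b k e r s kP ke rs sr.
have S j : {y : pobj A & {r : phom (P j) y & {s : phom y (P j) |
    r \pc s = pid y /\ s \pc r = E j}}}.
  by have /cid[y /cid[r' /cid[s' rs']]] := splitA (EI j); exists y, r', s'.
pose P' j := projT1 (S j); pose R j : phom (P j) (P' j) := projT1 (projT2 (S j)).
pose T j : phom (P' j) (P j) := sval (projT2 (projT2 (S j))).
have [RT TR] : (forall j, R j \pc T j = pid (P' j)) /\ (forall j, T j \pc R j = E j).
  by split=> j; have [] := svalP (projT2 (projT2 (S j))).
have RE j : R j \pc E j = R j by rewrite -TR pcompA RT pcomp_idl.
have ET j : E j \pc T j = T j by rewrite -TR -pcompA RT pcomp_idr.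
pose d' j : phom (P' j) (P' (j + 1)) := R (j + 1) \pc d j \pc T j.
(* needed for the kernels in the acyclicity of d' and for the kernel b *)
have kerS (j : int) c c' (kk : phom c (P j)) (ee : endo c) (r' : phom c c') (s' : phom c' c) :
    is_kernel (kk : mor (c : A) (P j)) (d j) -> kk \pc ee = E j \pc kk ->
    r' \pc s' = pid c' -> s' \pc r' = ee ->
    is_kernel (R j \pc kk \pc s' : mor (c' : A) (P' j)) (d' j).
  move=> /kerP[dk0 kkP kk_inj] kkE rs' sr'.
  have es : ee \pc s' = s' by rewrite -sr' -pcompA rs' pcomp_idr.
  have TRk t (v : phom t c) : T j \pc (R j \pc (kk \pc v)) = kk \pc (ee \pc v).
    by rewrite (pcomp_reassoc (TR j)) (pcomp_reassoc (esym kkE)) -!pcompA.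
  apply/kerP; split=> [|t u du0|t v].
  - by rewrite /d' -!pcompA TRk es (pcomp_reassoc dk0) pcomp0l pcomp0r.
  - have dTu : d j \pc (T j \pc u) = 0.
      rewrite -[T j]ET -pcompA (pcomp_reassoc (esym (Ed j))) -TR -!pcompA.
      by rewrite -[RHS](pcomp0r _ (T (j + 1))) -du0 /d' -!pcompA.
    have [v vE] := kkP _ _ dTu; exists (r' \pc v).
    rewrite -!pcompA (pcomp_reassoc sr') (pcomp_reassoc kkE) -!pcompA -vE.
    by rewrite (pcomp_reassoc (RE j)) (pcomp_reassoc (RT j)) pcomp_idl.
  - rewrite -!pcompA => /(f_equal (pcomp (T j))); rewrite pcomp0r.
    rewrite TRk (pcomp_reassoc es) => /kk_inj sv0.
    by rewrite -[v]pcomp_idl -rs' -pcompA sv0 pcomp0r.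
exists P', d'; split=> [j|]; first exact: (projective_retract (RT j)).
split=> [j|].
  have [K [kk [ee [kkP [epi_ee dE]]]]] := acP j.
  change (d j = (kk : phom K _) \pc ee) in dE.
  have /kerP[dk0 kkF kk_inj] := kkP.
  have [eK eKE] : exists eK, E (j + 1) \pc kk = kk \pc eK.
    by apply: kkF; rewrite pcompA -Ed -pcompA dk0 pcomp0r.
  have eKI : (eK : endo K) * eK = eK.
    apply/eqP; rewrite -subr_eq0; apply/eqP/kk_inj.
    rewrite pcompBr pcompA -!eKE -pcompA -eKE pcompA.
    by rewrite [E _ \pc E _]EI subrr.
  have [c [r' [s' [rs' sr']]]] := splitA eKI.
  exists c, (R (j + 1) \pc kk \pc s'), (r' \pc ee \pc T j).
  split; first by apply: (kerS _ _ _ kk eK r').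
  have eeE : ee \pc E j = eK \pc ee.
    apply/eqP; rewrite -subr_eq0; apply/eqP/kk_inj.
    by rewrite pcompBr !pcompA -eKE -dE -pcompA -dE Ed subrr.
  split.
    apply/epiP => z g; rewrite -!pcompA => g0.
    have {}g0 : g \pc r' = 0.
      apply: (proj1 (epiP _) epi_ee).
      have -> : r' = r' \pc eK by rewrite -sr' pcompA rs' pcomp_idl.
      have := f_equal (fun u => u \pc R j) g0.
      by rewrite -!pcompA -eeE -TR pcomp0l.
    by rewrite -[g]pcomp_idr -rs' pcompA g0 pcomp0l.
  change (R (j + 1) \pc d j \pc T j =
    R (j + 1) \pc kk \pc s' \pc (r' \pc ee \pc T j)).
  rewrite -!pcompA (pcomp_reassoc sr') (pcomp_reassoc (esym eKE)) -!pcompA.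
  by rewrite (pcomp_reassoc (RE _)) dE -!pcompA.
split; last by exists i, (R i \pc k \pc s); exact: (kerS _ _ _ k e r).
move=> q prq j h /zmP hd0.
change ((h : phom (P' (j + 1)) q) \pc d' j = 0) in hd0.
have [|h' h'E] := @complex_hom j q ((h : phom (P' (j + 1)) q) \pc R (j + 1)) prq.
  have := f_equal (fun u => u \pc R j) hd0.
  by rewrite /d' -!pcompA TR -Ed (pcomp_reassoc (RE _)) pcomp0l.
exists (h' \pc T (j + 1 + 1)).
change ((h : phom (P' (j + 1)) q) = h' \pc T (j + 1 + 1) \pc d' (j + 1)).
rewrite /d' -!pcompA (pcomp_reassoc (TR _)) (pcomp_reassoc (Ed _)) -!pcompA ET.
by rewrite pcompA -h'E -pcompA RT pcomp_idr.
Qed.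

Section LeftMinimal.
Hypothesis fitA : forall x : pobj A, fitting_object x.
Variables (i : int) (M Q : pobj A) (k : phom M (P (i + 1 + 1)))
  (p : phom (P (i + 1 + 1)) Q) (s : phom Q (P (i + 1 + 1))).
Hypotheses (kP : is_kernel (k : mor (M : A) (P _)) (d (i + 1 + 1)))
  (ps : p \pc s = pid Q) (spk : s \pc (p \pc k) = k)
  (minQ : forall e : endo Q, e * e = e -> e \pc (p \pc k) = p \pc k -> e = 1).

Let spI : (s \pc p : endo (P (i + 1 + 1))) * (s \pc p) = s \pc p.
Proof. by rewrite endoM -!pcompA (pcomp_reassoc ps) pcomp_idl. Qed.

(** The Fitting idempotent of [f] fixes [p k], so it is [1] by minimality. *)
Lemma kernel_left_minimal (f : endo Q) : f \pc (p \pc k) = p \pc k -> invertible f.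
Proof.
move=> fl; have [n [e [g [n0 eI fe gf fg]]]] := fitA f.
apply: (expr_invertible n0); exists g.
have flX m : (f ^+ m) \pc (p \pc k) = p \pc k.
  elim: m => [|m IHm]; first exact: pcomp_idl.
  by rewrite exprS endoM -pcompA IHm fl.
suff e1 : e = 1 by rewrite fg gf e1.
apply: minQ => //; rewrite -{1}(flX n) pcompA.
by rewrite -[e \pc _]endoM -fg -mulrA gf fe flX.
Qed.

(** The complement of [Q] meets the kernel trivially, so it maps isomorphically
    onto a direct summand of the next term.  Removing this contractible summand
    leaves a totally acyclic complex in which [Q] has replaced the given term, so
    that the image of its differential is [G = Q / M]. *)
Lemma kernel_cosyzygy : exists (G : pobj A) (q : phom Q G),
  [/\ gorenstein_projective (G : A), epimorphism (q : mor (Q : A) G) &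
      is_kernel (p \pc k : mor (M : A) Q) (q : mor (Q : A) G)].
Proof.
have [dk0 kF k_inj] := proj1 (kerP _ _) kP.
have [F FE0] : exists F, F = 1 - (s \pc p : endo (P (i + 1 + 1))) by eexists.
have FI : F \pc F = F by rewrite FE0; exact: (idem_compl spI).
have Fk0 : F \pc k = 0 by rewrite FE0 pcompBl pcomp_idl -pcompA spk subrr.
(* the projection F onto the complement vanishes on boundaries *)
have [F' FE] : exists F', F = F' \pc d (i + 1 + 1).
  apply: complex_hom => //; have [v ->] := kF _ _ (complex_comp (i + 1)).
  by rewrite pcompA Fk0 pcomp0l.
have [G0 [kap [e0 [kapP [epi_e0 dE]]]]] := acP (i + 1 + 1).
change (d (i + 1 + 1) = (kap : phom G0 _) \pc e0) in dE.
have /kerP[dkap0 kapF kap_inj] := kapP.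
(* D projects the next term onto the image of the complement *)
pose D : endo (P (i + 1 + 1 + 1)) := d (i + 1 + 1) \pc F \pc F'.
have DI : D * D = D.
  by rewrite endoM /D -!pcompA (pcomp_reassoc (esym FE)) !(pcomp_reassoc FI).
have DdE : D \pc d (i + 1 + 1) = d (i + 1 + 1) \pc F.
  by rewrite /D -!pcompA -FE FI.
pose E := dfwith (dfwith (fun j : int => (1 : endo (P j))) (s \pc p : endo _)) (1 - D).
have Ei2 : E (i + 1 + 1) = s \pc p.
  by rewrite /E dfwith_out ?dfwith_in //; lia.
have Ei3 : E (i + 1 + 1 + 1) = 1 - D by rewrite /E dfwith_in.
have Eout j : j != i + 1 + 1 -> j != i + 1 + 1 + 1 -> E j = 1.
  by move=> j2 j3; rewrite /E !dfwith_out // eq_sym.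
have EI j : E j * E j = E j.
  have [->|j2] := eqVneq j (i + 1 + 1); first by rewrite Ei2.
  have [->|j3] := eqVneq j (i + 1 + 1 + 1); first by rewrite Ei3 idem_compl.
  by rewrite Eout // mulr1.
have spE : s \pc p = 1 - F by rewrite FE0 subKr.
have Ed (j : int) : E (j + 1) \pc d j = d j \pc E j.
  have [->|j2] := eqVneq j (i + 1 + 1).
    rewrite Ei3 Ei2 spE pcompBl pcompBr DdE; congr (_ - _).
    by rewrite [LHS]pcomp_idl [RHS]pcomp_idr.
  have [->|j3] := eqVneq j (i + 1 + 1 + 1).
    rewrite Ei3 Eout; [|lia|lia]; rewrite pcompBr /D !pcompA complex_comp !pcomp0l subr0.
    by rewrite [LHS]pcomp_idl [RHS]pcomp_idr.
  have [->|j1] := eqVneq j (i + 1).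
    rewrite Ei2 spE Eout; [|lia|lia]; rewrite pcompBl FE -pcompA complex_comp pcomp0r.
    by rewrite subr0 [LHS]pcomp_idl [RHS]pcomp_idr.
  by rewrite !Eout; [rewrite [LHS]pcomp_idl [RHS]pcomp_idr| lia..].
have [e eE] : exists e, E (i + 1 + 1 + 1) \pc kap = kap \pc e.
  by apply: kapF; rewrite pcompA -Ed -pcompA dkap0 pcomp0r.
have eI : (e : endo G0) * e = e.
  apply/eqP; rewrite -subr_eq0; apply/eqP/kap_inj.
  by rewrite pcompBr pcompA -eE -pcompA -eE pcompA [E _ \pc E _]EI subrr.
have [G [r [t [rt tr]]]] := splitA eI.
have ee0 : e \pc e0 = e0 \pc (s \pc p).
  apply/eqP; rewrite -subr_eq0; apply/eqP/kap_inj.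
  by rewrite pcompBr !pcompA -eE -dE -pcompA -dE Ed Ei2 pcompA subrr.
have re : r \pc e = r by rewrite -tr pcompA rt pcomp_idl.
have sps : s \pc (p \pc s) = s by rewrite ps pcomp_idr.
exists G, (r \pc (e0 \pc s)); split.
- exact: (summand_gorenstein_projective EI Ed kapP (esym eE) rt tr).
- apply/epiP => z g; rewrite !pcompA => g0.
  suff gr0 : g \pc r = 0 by rewrite -[g]pcomp_idr -rt pcompA gr0 pcomp0l.
  apply: (proj1 (epiP _) epi_e0); rewrite -re -!pcompA ee0.
  by have := f_equal (fun u => u \pc p) g0; rewrite pcomp0l -!pcompA.
- have e0k : e0 \pc k = 0 by apply: kap_inj; rewrite pcompA -dE.
  apply/kerP; split=> [|u v v0|u v].
  + by rewrite -!pcompA spk e0k pcomp0r.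
  + have e0sv : e0 \pc (s \pc v) = 0.
      rewrite -[s]sps -!pcompA [s \pc (p \pc _)]pcompA (pcomp_reassoc (esym ee0)).
      rewrite -tr -!pcompA.
      by have := f_equal (pcomp t) v0; rewrite pcomp0r -!pcompA.
    have [w wE] : exists w, s \pc v = k \pc w.
      by apply: kF; rewrite dE -pcompA e0sv pcomp0r.
    by exists w; rewrite -pcompA -wE pcompA ps pcomp_idl.
  + move=> /(f_equal (pcomp s)); rewrite pcomp0r (pcomp_reassoc spk).
    exact: k_inj.
Qed.

End LeftMinimal.

End Complex.

Section ProjectiveCover.
Hypothesis fitA : forall x : pobj A, fitting_object x.
Variables (M Q G : pobj A) (l : phom M Q) (q : phom Q G).
Hypotheses (MI : indecomposable (M : A)) (MnP : ~ projective (M : A))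
  (prQ : projective (Q : A)) (epi_q : epimorphism (q : mor (Q : A) G))
  (lq : is_kernel (l : mor (M : A) Q) (q : mor (Q : A) G)).

(** A lift [h] of [q] through [q f] satisfies [q h = q], so the complement of its
    Fitting idempotent factors through [M].  It cannot be a nonzero summand of
    [M], because [M] is indecomposable and not projective, so [h] is invertible. *)
Lemma kernel_projective_cover : projective_cover (q : mor (Q : A) G).
Proof.
have [ql0 lF l_inj] := proj1 (kerP _ _) lq.
split=> //; split=> // y f epi_qf.
have [u uE] := @prQ _ _ _ (q : mor (Q : A) G) epi_qf.
change (q \pc f \pc u = q) in uE.
pose h : endo Q := f \pc u.
have qh : q \pc h = q by rewrite /h pcompA.
have [g [hg gh]] : invertible h.
  have [n [e [g [n0 eI he gh hg]]]] := fitA h.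
  apply: (expr_invertible n0); exists g; rewrite hg gh.
  suff -> : e = 1 by [].
  have qhX m : q \pc (h ^+ m) = q.
    elim: m => [|m IHm]; first exact: pcomp_idr.
    by rewrite exprS endoM pcompA qh IHm.
  have [w wE] : exists w, (1 - e : endo Q) = l \pc w.
    apply: lF; rewrite -(qhX n) -pcompA -[_ \pc (1 - e)]endoM mulrBr mulr1 he subrr.
    exact: pcomp0r.
  have wlw : w \pc (l \pc w) = w.
    apply/eqP; rewrite -subr_eq0; apply/eqP/l_inj; rewrite pcompBr -wE pcompA -wE.
    by rewrite -[_ \pc _]endoM idem_compl // subrr.
  have wlI : (w \pc l : endo M) * (w \pc l) = w \pc l.
    by rewrite endoM -pcompA [l \pc _]pcompA pcompA wlw.
  have [wl0|wl1] := indecomposable_idem splitA MI wlI.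
    apply/eqP; rewrite eq_sym -subr_eq0 wE -wlw; apply/eqP.
    by rewrite [w \pc _]pcompA wl0 pcomp0l pcomp0r.
  by case: MnP; exact: (projective_retract wl1).
apply/epiP => z a; rewrite -[X in _ -> X = 0]pcomp_idr -endo1 -hg => af0.
by rewrite endoM /h !pcompA af0 !pcomp0l.
Qed.

(** An idempotent of [G] lifts to the short exact sequence [M -> Q -> G], and one
    of the maps that it and its complement induce on [M] is invertible. *)
Lemma kernel_indecomposable :
  (forall (R : A) (f : phom M R), projective R -> exists g : phom Q R, f = g \pc l) ->
  (forall f : endo Q, f \pc l = l -> invertible f) ->
  indecomposable (G : A).
Proof.
move=> ext lmin; have [ql0 lF l_inj] := proj1 (kerP _ _) lq.
have q_epi := proj1 (epiP _) epi_q.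
apply: idem_indecomposable => [G0|e eI].
  have [v vE] := lF _ (pid Q) (hom0_zero_object _ G0).
  apply: MnP; apply: (projective_retract (r := v) (s := l)) => //.
  apply/eqP; rewrite -subr_eq0; apply/eqP/l_inj.
  by rewrite pcompBr pcompA -vE pcomp_idl pcomp_idr subrr.
(* left minimality makes f invertible, so that q factors through the image of a *)
have lift1 (a : endo G) (f : endo Q) (th : endo M) : a * a = a ->
    a \pc q = q \pc f -> f \pc l = l \pc th -> invertible th -> a = 1.
  move=> aI aq fl [th' [thK thK']].
  have [f' f'l] := ext Q (l \pc th') prQ.
  have [g [gK _]] : invertible (f * f' : endo Q).
    apply: lmin; rewrite endoM -pcompA -f'l pcompA fl -pcompA.
    by rewrite -[th \pc _]endoM thK pcomp_idr.
  have qE : q = a \pc (q \pc (f' \pc g)).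
    rewrite pcompA aq -!pcompA -{1}[q]pcomp_idr -endo1 -gK endoM endoM.
    by rewrite -!pcompA.
  apply/eqP; rewrite -subr_eq0; apply/eqP/q_epi.
  by rewrite pcompBl [X in _ - X]pcomp_idl {1 2}qE pcompA -[a \pc a]endoM aI subrr.
have [f fE] := @prQ _ _ _ (e \pc q : mor (Q : A) G) epi_q.
change (q \pc f = e \pc q) in fE.
have [th thE] : exists th, f \pc l = l \pc th.
  by apply: lF; rewrite pcompA fE -pcompA ql0 pcomp0r.
have [thI|[m thm]] := fitting_local th (@fitA M)
    (fun e => indecomposable_idem splitA MI).
  by right; apply: (lift1 e f th).
left; suff e1 : 1 - e = 1 by rewrite -[e](subKr 1) e1 subrr.
apply: (lift1 _ (1 - (f : endo Q)) (1 - (th : endo M))); first exact: idem_compl.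
- by rewrite pcompBl pcompBr fE; congr (_ - _); rewrite [LHS]pcomp_idl [RHS]pcomp_idr.
- by rewrite pcompBl pcompBr thE; congr (_ - _); rewrite [LHS]pcomp_idl [RHS]pcomp_idr.
- exact: nilpotent_invertible thm.
Qed.

End ProjectiveCover.
End Cosyzygy.

(** * Minimal summands *)

Section MinimalSummands.
Variables (A : preadditive) (splitA : split_idempotents A).
Hypothesis dccA : forall x : pobj A, idempotent_dcc x.

Lemma zero_projective (x : pobj A) : pid x = 0 -> projective (x : A).
Proof.
move=> x0 y z e f _; exists (0 : phom x y).
by rewrite [LHS]pcomp0r [RHS]zero_object_hom0.
Qed.

Lemma projective_sum (x y y' : pobj A) (r : phom x y) (s : phom y x)
    (r' : phom x y') (s' : phom y' x) : s \pc r + s' \pc r' = pid x ->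
  projective (y : A) -> projective (y' : A) -> projective (x : A).
Proof.
move=> sum1 pry pry' u v e f epi_e.
have [g gE] := pry u v e (f \pc s) epi_e.
have [g' g'E] := pry' u v e (f \pc s') epi_e.
exists (g \pc r + g' \pc r').
change (e \pc g = f \pc s) in gE; change (e \pc g' = f \pc s') in g'E.
change (e \pc (g \pc r + g' \pc r') = f).
by rewrite pcompDr !pcompA gE g'E -!pcompA -pcompDr sum1 pcomp_idr.
Qed.

(** The image of a minimal idempotent among those with nonprojective image. *)
Lemma nonprojective_summand (x : pobj A) : ~ projective (x : A) ->
  exists y (r : phom x y) (s : phom y x),
    [/\ r \pc s = pid y, indecomposable (y : A) & ~ projective (y : A)].
Proof.
move=> xnP.
pose S (e : endo x) := exists y (r : phom x y) (s : phom y x),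
  [/\ r \pc s = pid y, s \pc r = e & ~ projective (y : A)].
have S1 : S 1 by exists x, (pid x), (pid x); split=> //; exact: pcomp_idl.
have [e [eI [y [r [s [rs sr ynP]]]] emin]] := minimal_idempotent (@dccA x) (mulr1 1) S1.
exists y, r, s; split=> //.
apply: idem_indecomposable => [/zero_projective //|f fI].
have full (g : endo y) z (r' : phom y z) (s' : phom z y) : g * g = g ->
    r' \pc s' = pid z -> s' \pc r' = g -> ~ projective (z : A) -> g = 1.
  move=> gI rs' sr' znP.
  have gE : s \pc g \pc r = e.
    apply: emin.
    - rewrite endoM -!pcompA (pcomp_reassoc rs) pcomp_idl.
      by rewrite [g \pc (g \pc r)]pcompA -[g \pc g]endoM gI.
    - exists z, (r' \pc r), (s \pc s'); split=> //.
        by rewrite -!pcompA (pcomp_reassoc rs) pcomp_idl.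
      by rewrite -!pcompA (pcomp_reassoc sr').
    - by rewrite endoM -sr -!pcompA (pcomp_reassoc rs) pcomp_idl.
    - by rewrite endoM -sr -!pcompA (pcomp_reassoc rs) pcomp_idl.
  have := f_equal (fun u => r \pc (u \pc s)) gE.
  rewrite -sr -!pcompA rs !pcomp_idr (pcomp_reassoc rs) pcomp_idl => ->.
  exact: rs.
have [y1 [r1 [s1 [rs1 sr1]]]] := splitA fI.
have [y2 [r2 [s2 [rs2 sr2]]]] := splitA (idem_compl fI).
have [pr1|/full f1] := pselect (projective (y1 : A)); last by right; apply: (f1 f r1 s1).
have [pr2|npr2] := pselect (projective (y2 : A)).
  case: ynP; apply: (projective_sum (r := r1) (s := s1) (r' := r2) (s' := s2)) => //.
  by rewrite sr1 sr2 addrC subrK.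
left; suff e1 : 1 - f = 1 by rewrite -[f](subKr 1) e1 subrr.
exact: (full _ y2 r2 s2 (idem_compl fI)).
Qed.

(** A minimal summand of [P] through which [l] factors. *)
Lemma left_minimal_summand (M P : pobj A) (l : phom M P) :
  exists Q (p : phom P Q) (s : phom Q P), [/\ p \pc s = pid Q, s \pc (p \pc l) = l &
    forall e : endo Q, e * e = e -> e \pc (p \pc l) = p \pc l -> e = 1].
Proof.
have [|e [eI el emin]] := @minimal_idempotent A P (fun e => e \pc l = l) 1 (@dccA P) (mulr1 1).
  exact: pcomp_idl.
have [Q [p [s [ps sp]]]] := splitA eI.
exists Q, p, s; split=> // [|f fI fl]; first by rewrite pcompA sp.
have fE : s \pc f \pc p = e.
  apply: emin.
  - rewrite endoM -!pcompA (pcomp_reassoc ps) pcomp_idl.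
    by rewrite [f \pc (f \pc p)]pcompA -[f \pc f]endoM fI.
  - by rewrite -!pcompA fl pcompA sp.
  - by rewrite endoM -sp -!pcompA (pcomp_reassoc ps) pcomp_idl.
  - by rewrite endoM -sp -!pcompA (pcomp_reassoc ps) pcomp_idl.
have := f_equal (fun u => p \pc (u \pc s)) fE.
rewrite -sp -!pcompA ps !pcomp_idr (pcomp_reassoc ps) pcomp_idl => ->.
exact: ps.
Qed.

End MinimalSummands.

Section StableSplitting.
Variables (R : pzRingType) (x y : fgmod R) (f : phom x y) (g : phom y x).
Hypothesis fitA : forall x : fgmod R, fitting_object (A := fgmod R) x.
Hypothesis dccA : forall x : fgmod R, idempotent_dcc (A := fgmod R) x.
Hypotheses (fgf : factors_through_projective (f - f \pc g \pc f))
  (fnP : ~ factors_through_projective f).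

(** The idempotent [g f] of the stable category lifts to the Fitting idempotent
    of [g f], on whose image [f] is a split monomorphism. *)
Lemma stable_splitting : exists (M : fgmod R) (a : phom M x) (b : phom y M),
  [/\ b \pc f \pc a = pid M, indecomposable M & ~ projective M].
Proof.
have splitA := @split_fgmod R.
have fgfJ : f - f \pc g \pc f \in @projective_maps R x y by apply/projective_mapsP.
pose h : endo (A := fgmod R) x := g \pc f.
have [m [e [d [m0 eI he dh hd]]]] := fitA h.
have [M [r [s [rs sr]]]] := splitA _ _ eI.
case: m m0 he dh hd => // m _ he dh hd.
pose b := r \pc (d \pc (h ^+ m \pc g)).
have bfs : b \pc (f \pc s) = pid M.
  have -> : b \pc (f \pc s) = r \pc (d * h ^+ m.+1 \pc s).
    by rewrite exprSr !endoM /b /h -!pcompA.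
  by rewrite dh -sr -!pcompA rs pcomp_idr rs.
have MnP : ~ projective (M : fgmod R).
  move=> prM; apply: fnP; apply/projective_mapsP.
  have hmJ : (h ^+ m.+1 : phom x x) \in @projective_maps R x x.
    apply/projective_mapsP; exists M; split=> //.
    by exists r, (h ^+ m.+1 \pc s); rewrite -pcompA sr -endoM he.
  have hJ q : (h ^+ q.+1 - h : phom x x) \in @projective_maps R x x.
    elim: q => [|q IHq]; first by rewrite expr1 subrr rpred0.
    have -> : h ^+ q.+2 - h = h \pc (h ^+ q.+1 - h) - g \pc (f - f \pc g \pc f).
      rewrite !pcompBr [h ^+ q.+2]exprS endoM opprB addrA.
      rewrite [g \pc (f \pc g \pc f)](_ : _ = h \pc h) ?subrK //.
      by rewrite /h !pcompA.
    by apply: rpredB; apply: projective_maps_compl.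
  have hJ' : (h : phom x x) \in @projective_maps R x x.
    by have := rpredB hmJ (hJ m); rewrite opprB addrC subrK.
  rewrite -[f](subrK (f \pc g \pc f)); apply: rpredD => //.
  by rewrite -pcompA; apply: projective_maps_compl.
have [N [r' [s' [rs' NI NnP]]]] := nonprojective_summand splitA dccA MnP.
exists N, (s \pc s'), (r' \pc b); split=> //.
by rewrite -rs' -[s' in RHS]pcomp_idl -bfs !pcompA.
Qed.

End StableSplitting.

(** * Recognizing the indecomposable representations *)

(** In each case below a representation of the required form is exhibited as a
    nonzero direct summand of the indecomposable representation [X]. *)

Section Recognition.
Variables (A : preadditive) (n : nat) (o : pobj A) (o0 : pid o = 0).
Hypothesis splitA : split_idempotents A.
Local Notation Q := (linear_quiver n).
Local Notation rep := (rep_category Q A).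
Variables (X : rep) (i m : 'I_n).
Hypotheses (XI : indecomposable X) (le_m : forall v : 'I_n, (v <= m)%N)
  (X0 : forall v : 'I_n, (v < i)%N -> pid (X v) = 0).

Section Projective.
Variable h : phom (X m) (X i).
Hypotheses (hE : h \pc path_map X i m = pid (X i)) (Xi0 : pid (X i) <> 0).

Lemma path_section (w : 'I_n) : (i <= w)%N -> h \pc path_map X w m \pc path_map X i w = pid (X i).
Proof. by move=> iw; rewrite -pcompA path_comp. Qed.

(** An idempotent of [X i] induces one of [X], because [h] splits off
    [X i] from all later vertices. *)
Lemma first_indecomposable : indecomposable (X i : A).
Proof.
apply: idem_indecomposable => // e eI.
pose Ef w : phom (X w) (X w) := path_map X i w \pc e \pc h \pc path_map X w m.
have EP w w' (a : @arrow Q w w') :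
    Ef w' \pc rep_arr X a = rep_arr X a \pc Ef w.
  have ww' : w.+1 = w' :> nat := a.
  have [iw|/X0 Xw0] := leqP i w; last first.
    by rewrite [LHS]zero_object_hom0 // [RHS]zero_object_hom0.
  by rewrite /Ef (path_rcons X a iw) (path_cons X a) // !pcompA.
pose E := @mk_rep Q A X X Ef EP.
have EI v : rep_at E v \pc rep_at E v = rep_at E v.
  have [iw|/X0 Xw0] := leqP i v; last first.
    by rewrite [LHS]zero_object_hom0 // [RHS]zero_object_hom0.
  change (Ef v \pc Ef v = Ef v); rewrite /Ef -!pcompA.
  rewrite [h \pc (path_map X v m \pc (path_map X i v \pc _))]pcompA.
  by rewrite (pcomp_reassoc (path_section iw)) pcomp_idl [e \pc (e \pc _)]pcompA
    -[e \pc e]endoM eI.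
have EiE : rep_at E i = e.
  by change (Ef i = e); rewrite /Ef path_id pcomp_idl -pcompA hE pcomp_idr.
have [E0|E1] := indecomposable_rep_idem splitA XI EI; [left|right].
  by rewrite -EiE E0.
by rewrite -EiE E1.
Qed.

Lemma isomorphic_constant : i = 0%N :> nat -> isomorphic X (constant_rep (X i : A)).
Proof.
move=> i0; have le_i v : (i <= v)%N by rewrite i0.
have sP w w' (a : @arrow Q w w') : path_map X i w' \pc
    rep_arr (constant_rep (X i : A) : rep) a = rep_arr X a \pc path_map X i w.
  rewrite (path_rcons X a (le_i w)); exact: (@pcomp_idr A).
have rP w w' (a : @arrow Q w w') : (h \pc path_map X w' m) \pc rep_arr X a =
    rep_arr (constant_rep (X i : A) : rep) a \pc (h \pc path_map X w m).
  rewrite -pcompA -(path_cons X a) //; symmetry; exact: (@pcomp_idl A).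
pose s := @mk_rep Q A (constant_rep (X i : A)) X _ sP.
pose r := @mk_rep Q A X (constant_rep (X i : A)) _ rP.
have rs v : rep_at r v \pc rep_at s v = pid (X i) by exact: path_section.
have sr := @indecomposable_rep_retract Q A X (constant_rep (X i : A)) r s i splitA XI Xi0 rs.
exact: (@rep_iso_isomorphic Q A X (constant_rep (X i : A)) r s rs sr).
Qed.

Lemma isomorphic_ind : isomorphic X (ind o i (X i : A)).
Proof.
pose rf w b : phom (X w) (block_obj o o (X i) b) :=
  match b with BlockP => h \pc path_map X w m | _ => 0 end.
have rP w w' (a : @arrow Q w w') : rf w' (block_of 1 i w'.+1) \pc rep_arr X a =
    block_map o (0 : phom o (X i)) (block_of 1 i w.+1) (block_of 1 i w'.+1) \pc
    rf w (block_of 1 i w.+1).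
  have ww' : w.+1 = w' :> nat := a; rewrite !block_of1 /rf.
  case: (ltnP w i) => [/X0 Xw0|iw].
    by rewrite [LHS]zero_object_hom0 // [RHS]zero_object_hom0.
  rewrite (_ : (w' < i)%N = false) /=; last by lia.
  by rewrite pcomp_idl -pcompA -(path_cons X a).
pose r := @mk_rep Q A X (ind o i (X i : A)) _ rP.
pose s := ind_hom o0 (pid (X i) : phom (X i : A) (X i)).
have rs v : rep_at r v \pc rep_at s v = pid (ind o i (X i : A) v).
  change (rf v (block_of 1 i v.+1) \pc ind_fun o (pid (X i)) v (block_of 1 i v.+1) =
    pid (block_obj o o (X i) (block_of 1 i v.+1))).
  rewrite block_of1 /rf; case: ltnP => /= iv; first by rewrite pcomp0l o0.
  by rewrite pcomp_idr path_section.
have Xi0' : pid (ind o i (X i : A) i) <> 0.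
  change (pid (block_obj o o (X i) (block_of 1 i i.+1)) <> 0).
  by rewrite ind_block.
exact: (rep_iso_isomorphic rs (indecomposable_rep_retract splitA XI Xi0' rs)).
Qed.

End Projective.

Section Bracket.
Variables (j : 'I_n) (le_ij : (i <= j)%N) (M P : pobj A) (l : phom M P)
  (a : phom M (X i)) (b : phom (X j) M) (c : phom (X m) P)
  (e : forall w : 'I_n, phom P (X w)).
Hypotheses (ba : b \pc path_map X i j \pc a = pid M) (M0 : pid M <> 0)
  (cE : c \pc path_map X j m = l \pc b)
  (eP : forall w w' (f : @arrow Q w w'), (j < w)%N -> e w' = rep_arr X f \pc e w)
  (el : forall w : 'I_n, j.+1 = w :> nat -> e w \pc l = path_map X i w \pc a)
  (ce : forall w : 'I_n, (j < w)%N -> c \pc path_map X w m \pc e w = pid P).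

Local Notation blk w := (block_of i.+1 j.+1 w.+1).

Lemma isomorphic_bracket : isomorphic X (bracket_rep o l n i.+1 j.+1) /\
  a \pc (b \pc path_map X i j) = pid (X i).
Proof.
pose B : rep := bracket_rep o l n i.+1 j.+1.
pose sf w t : phom (block_obj o M P t) (X w) :=
  match t with BlockZ => 0 | BlockK => path_map X i w \pc a | BlockP => e w end.
pose rf w t : phom (X w) (block_obj o M P t) :=
  match t with
  | BlockZ => 0 | BlockK => b \pc path_map X w j | BlockP => c \pc path_map X w m end.
have blkE (w : 'I_n) : blk w = if (w < i)%N then BlockZ else
    if (w <= j)%N then BlockK else BlockP by [].
have sP w w' (f : @arrow Q w w') : sf w' (blk w') \pc block_map o l (blk w) (blk w') =
    rep_arr X f \pc sf w (blk w).
  have ww' : w.+1 = w' :> nat := f; rewrite !blkE /sf.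
  case: (ltnP w i) => [wi|iw] /=; first by rewrite !pcomp0r.
  rewrite (_ : (w' < i)%N = false) /=; last by lia.
  case: (leqP w j) => [wj|jw]; case: (leqP w' j) => [w'j|jw'] /=; last 1 first.
  - by rewrite pcomp_idr (eP f jw).
  - by rewrite pcomp_idr (path_rcons X f iw) pcompA.
  - have wj' : w = j by apply: val_inj => /=; lia.
    by subst w; rewrite el // (path_rcons X f iw) pcompA.
  - by lia.
have rP w w' (f : @arrow Q w w') : rf w' (blk w') \pc rep_arr X f =
    block_map o l (blk w) (blk w') \pc rf w (blk w).
  have ww' : w.+1 = w' :> nat := f; rewrite !blkE /rf.
  case: (ltnP w i) => [/X0 Xw0|iw] /=.
    by rewrite [LHS]zero_object_hom0 // [RHS]zero_object_hom0.
  rewrite (_ : (w' < i)%N = false) /=; last by lia.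
  case: (leqP w j) => [wj|jw]; case: (leqP w' j) => [w'j|jw'] /=; last 1 first.
  - by rewrite pcomp_idl -pcompA -(path_cons X f).
  - by rewrite pcomp_idl -pcompA -(path_cons X f).
  - have wj' : w = j by apply: val_inj => /=; lia.
    by subst w; rewrite -pcompA -(path_cons X f) // cE path_id pcomp_idr.
  - by lia.
pose s := @mk_rep Q A B X _ sP; pose r := @mk_rep Q A X B _ rP.
have rs v : rep_at r v \pc rep_at s v = pid (B v).
  change (rf v (blk v) \pc sf v (blk v) = pid (block_obj o M P (blk v))).
  rewrite blkE /rf /sf; case: (ltnP v i) => [vi|iv] /=; first by rewrite pcomp0l o0.
  case: leqP => /= [vj|jv]; last exact: ce.
  by rewrite -ba -!pcompA [path_map X v j \pc _]pcompA path_comp.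
have Bi : blk i = BlockK by rewrite blkE ltnn le_ij.
have M0' : pid (B i) <> 0 by change (pid (block_obj o M P (blk i)) <> 0); rewrite Bi.
have sr := indecomposable_rep_retract splitA XI M0' rs.
split; first exact: (rep_iso_isomorphic rs sr).
have := sr i; change (sf i (blk i) \pc rf i (blk i) = pid (X i) -> 
  a \pc (b \pc path_map X i j) = pid (X i)).
by rewrite Bi /= path_id pcomp_idl.
Qed.

End Bracket.

End Recognition.

(** * The classification *)

Section BracketMaps.
Variables (R : pzRingType) (n : nat).
Local Notation A := (fgmod R).
Variables (X : rep_category (linear_quiver n) A) (i j m : 'I_n).
Hypotheses (XG : gorenstein_projective X) (le_m : forall v : 'I_n, (v <= m)%N)
  (le_ij : (i <= j)%N)
  (jmax : forall w : 'I_n, j.+1 = w :> nat -> factors_through_projective (path_map X i w)).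
Variables (M P : A) (l : phom M P) (a : phom M (X i)) (b : phom (X j) M).
Hypotheses (ba : b \pc path_map X i j \pc a = pid M) (prP : projective P)
  (ext : forall (T : A) (f : phom M T), projective T -> exists g : phom P T, f = g \pc l)
  (lmin : forall f : endo (A := A) P, f \pc l = l -> invertible f).

(** The map [M -> X (j + 1)] factors through a projective, so it extends along [l],
    and [l b] extends to the last vertex.  If there is a vertex after [j], the two
    extensions compose to an
    endomorphism of [P] that fixes [l]; left minimality makes it invertible, and
    its inverse corrects the second extension. *)
Lemma bracket_maps : exists (c : phom (X m) P) (e : forall w : 'I_n, phom P (X w)),
  [/\ c \pc path_map X j m = l \pc b,
      (forall w w' (f : @arrow (linear_quiver n) w w'), (j < w)%N ->
         e w' = rep_arr X f \pc e w),
      (forall w : 'I_n, j.+1 = w :> nat -> e w \pc l = path_map X i w \pc a) &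
      (forall w : 'I_n, (j < w)%N -> c \pc path_map X w m \pc e w = pid P)].
Proof.
have [c cE] := gorenstein_projective_path_extension (zero_fgmod0 R)
  (l \pc b : phom (X j) P) XG prP (le_m j).
have [lt_n|ge_n] := ltnP j.+1 n; last first.
  exists c, (fun=> 0); split=> // w; have := ltn_ord w; lia.
pose j' : 'I_n := Ordinal lt_n.
have [T [prT [g [h pathE]]]] := jmax (w := j') erefl.
have [g' g'E] := ext (g \pc a) prT.
have [e0 e0l] : exists e0 : phom P (X j'), e0 \pc l = path_map X i j' \pc a.
  by exists (h \pc g'); rewrite pathE -!pcompA g'E.
have ba' : b \pc (path_map X i j \pc a) = pid M by rewrite pcompA.
have epsl : c \pc path_map X j' m \pc e0 \pc l = l.
  rewrite -!pcompA e0l [path_map X j' m \pc _]pcompA path_comp ?le_m //; last exact: leqW.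
  by rewrite -(path_comp X le_ij (le_m j)) -!pcompA (pcomp_reassoc cE) -pcompA ba' pcomp_idr.
have [u [_ uK]] := lmin epsl.
have ul : u \pc l = l by rewrite -{1}epsl pcompA -[u \pc _]endoM uK pcomp_idl.
exists (u \pc c), (fun w => path_map X j' w \pc e0); split=> [|w w' f jw|w jw|w jw].
- by rewrite -pcompA cE pcompA ul.
- by rewrite (path_rcons (v := j') X f jw) pcompA.
- by rewrite (_ : w = j') ?path_id ?pcomp_idl //; apply: val_inj.
- by rewrite -!pcompA [path_map X w m \pc _]pcompA path_comp // [c \pc _]pcompA.
Qed.

End BracketMaps.

Theorem proposition5p11 (k : comPzRingType) (L : algType k)
    (hL : G_semisimple L) (n : nat) (hn : (1 <= n)%N)
    (X : rep_category (linear_quiver n) (fgmod L^c))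
    (hXG : gorenstein_projective X) (hXI : indecomposable X) :
  (exists (G K P : fgmod L^c) (p : mor P G) (l : mor K P) (i j : nat),
      gorenstein_projective G /\ indecomposable G /\
      projective_cover p /\ is_kernel l p /\
      (1 <= i <= j)%N /\ (j <= n)%N /\
      isomorphic X (bracket_rep (fgmod0 L^c) l n i j)) \/
  (exists P : fgmod L^c,
      projective P /\ indecomposable P /\ isomorphic X (constant_rep P)).
Proof.
set A := fgmod L^c; set o : A := fgmod0 L^c.
have [artL [_ [_ prF]]] := hL.
have fitA : forall x : A, fitting_object (A := A) x := @fitting_fgmod k L artL.
have dccA : forall x : A, idempotent_dcc (A := A) x := @idempotent_dcc_fgmod k L artL.
have splitA : split_idempotents A := @split_fgmod L^c.
have o0 : pid o = 0 := zero_fgmod0 L^c.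
have lt_m : (n.-1 < n)%N by lia.
pose m : 'I_n := Ordinal lt_m.
have le_m (v : 'I_n) : (v <= m)%N by have := ltn_ord v; rewrite /=; lia.
have [v0 Xv0] : exists v : 'I_n, `[< pid (X v) <> 0 >].
  apply: contrapT => noV; apply: (proj1 hXI); apply/rep_zero_objectP => v.
  by apply: contrapT => Xv; apply: noV; exists v; apply/asboolP.
have [i /asboolP Xi0 imin] : exists2 i : 'I_n, `[< pid (X i) <> 0 >] &
    forall v : 'I_n, `[< pid (X v) <> 0 >] -> (i <= v)%N.
  by case: (@arg_minnP _ v0 (fun v : 'I_n => `[< pid (X v) <> 0 >]) val Xv0) => i; exists i.
have X0 (v : 'I_n) : (v < i)%N -> pid (X v) = 0.
  by rewrite ltnNge => vi; apply: contrapT => Xv; case/negP: vi; apply/imin/asboolP.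
have [prXi|nprXi] := pselect (projective (X i : A)).
  have [h hE] := gorenstein_projective_path_extension o0 (pid (X i)) hXG prXi (le_m i).
  have XiI : indecomposable (X i : A) := first_indecomposable splitA hXI le_m X0 hE Xi0.
  have [i0|i_gt0] := posnP i.
    by right; exists (X i); split=> //; split=> //; exact: (isomorphic_constant splitA hXI le_m hE).
  left; exists (X i), o, (X i), (idm (X i)), (0 : phom o (X i)), 1%N, i.
  split; first exact: (gorenstein_projective_at o0).
  split=> //; split.
    split=> //; split=> [Z g h' |Y f]; first by rewrite !comp_idr.
    by rewrite comp_idl.
  split.
    apply/(kernelP (proj2 (zero_objectP o) o0)); split=> [|t u|t v _].
    - by rewrite pcomp0r.
    - by rewrite pcomp_idl => ->; exists 0; rewrite pcomp0r.
    - exact: hom0_zero_object.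
  split; first by rewrite i_gt0.
  split; first by have := ltn_ord i; lia.
  exact: (isomorphic_ind o0 splitA hXI le_m X0 hE Xi0).
left.
have npath_i : ~ factors_through_projective (path_map X i i).
  rewrite path_id => -[T [prT [g [h ghE]]]]; apply: nprXi.
  exact: (projective_retract (esym ghE)).
have [j /andP[le_ij /asboolP npath_j] jmax] : exists2 j : 'I_n,
    (i <= j)%N && `[< ~ factors_through_projective (path_map X i j) >] &
    forall v : 'I_n, (i <= v)%N && `[< ~ factors_through_projective (path_map X i v) >] ->
      (v <= j)%N.
  have Si : (i <= i)%N && `[< ~ factors_through_projective (path_map X i i) >].
    by rewrite leqnn; apply/asboolP.
  by case: (@arg_maxnP _ i (fun v : 'I_n =>
    (i <= v)%N && `[< ~ factors_through_projective (path_map X i v) >]) val Si) => j; exists j.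
have jmax' (w : 'I_n) : j.+1 = w :> nat -> factors_through_projective (path_map X i w).
  move=> jw; apply: contrapT => npath_w.
  suff: (w <= j)%N by lia.
  by apply: jmax; apply/andP; split; [lia | apply/asboolP].
have gX v : gorenstein_projective (X v : A) := gorenstein_projective_at o0 v hXG.
have [g gE] := stable_regular (path_map X i j) prF (gX i) (gX j).
have [M [a [b [ba MI MnP]]]] := stable_splitting fitA dccA gE npath_j.
have [C [d [prC [acC [homC [c' ]]]]]] := gX i.
have [c ->] : exists c, c' = c + 1 + 1 by exists (c' - 2); lia.
move=> [kX kXP].
pose l0 : phom M (C (c + 1 + 1)) := (kX : phom (X i) _) \pc a.
have [P [p [s [ps spl minP]]]] := left_minimal_summand splitA dccA l0.
pose l := p \pc l0.
have prP : projective (P : A) := projective_retract ps (prC _).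
have lmin := kernel_left_minimal fitA minP.
have ext (T : A) (f : phom M T) : projective T -> exists g : phom P T, f = g \pc l.
  move=> prT.
  have [h hE] := kernel_extension o0 acC homC (f \pc (b \pc path_map X i j)) kXP prT.
  exists (h \pc s); rewrite /l -pcompA spl pcompA -hE.
  by rewrite -pcompA ba pcomp_idr.
have M0 : pid M <> 0 by move=> M0; apply: MnP; exact: zero_projective.
have [cm [e [cE eP el ce]]] := bracket_maps hXG le_m le_ij jmax' ba prP ext lmin.
have [isoX ab] := isomorphic_bracket o0 splitA hXI le_m X0 le_ij ba M0 cE eP el ce.
have l0P : is_kernel (l0 : mor M _) (d (c + 1 + 1)).
  have /(kernelP (proj2 (zero_objectP o) o0))[dk kF k_inj] := kXP.
  apply/(kernelP (proj2 (zero_objectP o) o0)); split=> [|t u du|t v].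
  - by rewrite /l0 pcompA dk pcomp0l.
  - have [v ->] := kF t u du; exists (b \pc path_map X i j \pc v).
    by rewrite /l0 -!pcompA [b \pc (_ \pc v)]pcompA (pcomp_reassoc ab) pcomp_idl.
  - rewrite -pcompA => /k_inj av.
    by rewrite -[v]pcomp_idl -ba -[_ \pc v]pcompA av pcomp0r.
have [G [q [gG epi_q lq]]] := kernel_cosyzygy o0 splitA prC acC homC l0P ps spl.
exists G, M, P, q, l, i.+1, j.+1.
split=> //; split.
  exact: (kernel_indecomposable o0 splitA fitA MI MnP prP epi_q lq ext lmin).
split; first exact: (kernel_projective_cover o0 splitA fitA MI MnP prP epi_q lq).
by split.
Qed.
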